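(* Let $\mathcal{T}_h$ be a regular triangulation of a bounded polyhedral Lipschitz domain $\Omega\subset\mathbb{R}^d$ with boundary partition $\partial\Omega=\Gamma_D\cup\Gamma_N$. If $\Gamma_D\neq\partial\Omega$, then $$\Pi_h\,\mathcal{S}^{1,cr}_D(\mathcal{T}_h)=\mathcal{L}^0(\mathcal{T}_h).$$ Otherwise (i.e. if $\Gamma_D=\partial\Omega$), the subspace $\Pi_h\,\mathcal{S}^{1,cr}_D(\mathcal{T}_h)\subset\mathcal{L}^0(\mathcal{T}_h)$ has codimension at most one.
   Context: Let $d$ be a positive integer and $\Omega\subset\mathbb{R}^d$ a bounded polyhedral Lipschitz domain (in particular connected). Let $\mathcal{T}_h$ be a regular (conforming, finite) triangulation of $\Omega$ into closed nondegenerate $d$-simplices, called elements. $\mathcal{S}_h$ is the set of sides ($(d-1)$-dimensional faces) of elements; $x_S$ is the barycenter (midpoint) of a side $S$. The boundary $\partial\Omega$ is partitioned into $\Gamma_D$ and $\Gamma_N$: $\Gamma_D$ is a (possibly empty) union of boundary sides and $\Gamma_N$ is the union of the remaining boundary sides (possibly empty). $P_k(T)$ is the set of polynomials of total degree at most $k$ on $T$, and $\mathcal{L}^k(\mathcal{T}_h)=\{w_h\in L^\infty(\Omega): w_h|_T\in P_k(T)$ for all $T\in\mathcal{T}_h\}$. $\Pi_h:L^1(\Omega)\to\mathcal{L}^0(\mathcal{T}_h)$ is the $L^2$ projection onto elementwise constant functions, i.e. $\Pi_h v|_T=|T|^{-1}\int_T v\,dx$. Crouzeix--Raviart space: $\mathcal{S}^{1,cr}(\mathcal{T}_h)=\{v_h\in\mathcal{L}^1(\mathcal{T}_h):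 v_h$ is continuous at $x_S$ for all $S\in\mathcal{S}_h\}$ (for an interior side, the values at $x_S$ from the two adjacent elements agree), and $\mathcal{S}^{1,cr}_D(\mathcal{T}_h)=\{v_h\in\mathcal{S}^{1,cr}(\mathcal{T}_h): v_h(x_S)=0$ for all $S\in\mathcal{S}_h$ with $S\subset\Gamma_D\}$. *)

(* Defs.v *)
From HB Require Import structures.
From mathcomp Require Import all_boot all_order all_algebra finmap.
From mathcomp Require Import all_classical all_reals all_analysis.
From mathcomp Require mpoly.
Set Implicit Arguments.
Unset Strict Implicit.
Unset Printing Implicit Defensive.
Import Order.TTheory GRing.Theory Num.Theory.
Import numFieldNormedType.Exports.

Local Open Scope classical_set_scope.
Local Open Scope ring_scope.

Definition rV_display : measure_display -> measure_display.
Proof. exact. Qed.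

(* The product sigma-algebra, generated by the coordinate maps; for [T] the
   real line this is the Borel sigma-algebra of ['rV[R]_n]. *)
Section measurable_rV.
Context {d : measure_display} {T : measurableType d}.
Variable n : nat.

Let coord : 'I_n -> 'rV[T]_n -> T := fun i x => x ord0 i.

Let rV_set0 : g_sigma_preimage coord set0.
Proof. exact: sigma_algebra0. Qed.

Let rV_setC A : g_sigma_preimage coord A -> g_sigma_preimage coord (~` A).
Proof. exact: sigma_algebraC. Qed.

Let rV_bigcup (F : (set 'rV[T]_n)^nat) :
  (forall i, g_sigma_preimage coord (F i)) ->
  g_sigma_preimage coord (\bigcup_i (F i)).
Proof. exact: sigma_algebra_bigcup. Qed.

HB.instance Definition _ := @isMeasurable.Build (rV_display d)
  'rV[T]_n (g_sigma_preimage coord) rV_set0 rV_setC rV_bigcup.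

End measurable_rV.

Section measurable_coord.
Context {d d' : measure_display} {T : measurableType d} {T' : measurableType d'}.

Lemma measurable_coord n (i : 'I_n) :
  measurable_fun [set: 'rV[T]_n] (fun x : 'rV[T]_n => x ord0 i).
Proof.
move=> _ Y mY; rewrite setTI; apply: sub_sigma_algebra => /=.
rewrite -bigcup_seq/=; exists i => /=; first by rewrite mem_index_enum.
by exists Y => //; rewrite setTI.
Qed.

Lemma measurable_fun_rV n (f : T' -> 'rV[T]_n) :
  (forall i, measurable_fun [set: T'] (fun x => f x ord0 i)) ->
  measurable_fun [set: T'] f.
Proof.
move=> mf _ A mA; rewrite setTI.
have : <<s \big[setU/set0]_(i < n)
    preimage_set_system setT (fun x : 'rV[T]_n => x ord0 i) measurable >>
  `<=` [set B | measurable (f @^-1` B)].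
  apply: smallest_sub.
    split => /=.
    - by rewrite preimage_set0.
    - by move=> B mB; rewrite setTD -preimage_setC; exact: measurableC.
    - by move=> F mF; rewrite preimage_bigcup; exact: bigcup_measurable.
  rewrite -bigcup_seq => B [i _] [C mC <-] /=.
  by rewrite setTI -comp_preimage -[X in measurable X]setTI; exact: mf.
exact.
Qed.

End measurable_coord.

Section lebesgue_rV.
Context {R : realType}.

Definition rV_cons (n : nat) (p : R * 'rV[R]_n) : 'rV[R]_n.+1 :=
  row_mx (const_mx p.1 : 'rV[R]_1) p.2.

Lemma measurable_rV_cons n : measurable_fun [set: R * 'rV[R]_n] (@rV_cons n).
Proof.
apply: measurable_fun_rV => i; case: (split_ordP (i : 'I_(1 + n))) => j ->.
- have -> : (fun x => rV_cons x ord0 (lshift n j)) = fst.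
    by apply/funext => x; apply: etrans (row_mxEl _ _ _ _) _; rewrite mxE.
  exact: measurable_fst.
- have -> : (fun x => rV_cons x ord0 (rshift 1 j)) =
      (fun y : 'rV[R]_n => y ord0 j) \o snd.
    by apply/funext => x; exact: row_mxEr.
  by apply: measurableT_comp => //; exact: measurable_coord.
Qed.

(* The pushforward of the product measure under [rV_cons]. *)
Fixpoint lebesgue_rV (n : nat) : {measure set 'rV[R]_n -> \bar R} :=
  match n with
  | 0 => \d_(0 : 'rV[R]_0)
  | n'.+1 => measure_function_pushforward__canonical__measure_function_Measure
       (lebesgue_measure \x^ lebesgue_rV n')%E (@measurable_rV_cons n')
  end.

Lemma measurable_box n (A : 'I_n -> set R) :
  (forall i, measurable (A i)) ->
  measurable [set x : 'rV[R]_n | forall i, A i (x ord0 i)].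
Proof.
move=> mA.
have -> : [set x : 'rV[R]_n | forall i, A i (x ord0 i)] =
    \big[setI/setT]_(i < n) ((fun x : 'rV[R]_n => x ord0 i) @^-1` A i).
  apply/seteqP; split => x /=; rewrite -bigcap_seq.
    by move=> h i _; exact: h.
  by move=> h i; apply: (h i); rewrite /= mem_index_enum.
apply: bigsetI_measurable => i _; rewrite -[X in measurable X]setTI.
exact: measurable_coord.
Qed.

Lemma lebesgue_rV_box n (A : 'I_n -> set R) :
  (forall i, measurable (A i)) ->
  lebesgue_rV n [set x | forall i, A i (x ord0 i)] =
  (\prod_(i < n) lebesgue_measure (A i))%E.
Proof.
elim: n A => [|n ih] A mA.
  rewrite big_ord0 /= diracE mem_set//= => -[]//.
rewrite big_ord_recl /= /pushforward.
rewrite -(ih (fun i => A (lift ord0 i)))//.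
have mA0 : measurable (A ord0) by exact: mA.
have mA1 : measurable [set x : 'rV[R]_n | forall i, A (lift ord0 i) (x ord0 i)].
  by apply: (@measurable_box n (fun i => A (lift ord0 i))) => i; exact: mA.
rewrite -product_measure2E//.
congr (product_measure2 _ _ _); apply/seteqP.
split => [[t y] h|[t y] /= [h1 h2] i].
  split => /= [|i].
    have := h ord0; rewrite /rV_cons.
    have -> : (ord0 : 'I_n.+1) = lshift n (ord0 : 'I_1) by apply/val_inj.
    by rewrite (_ : fun_of_matrix _ _ _ = t)//;
      apply: etrans (row_mxEl _ _ _ _) _; rewrite mxE.
  have := h (lift ord0 i).
  have -> : (lift ord0 i : 'I_n.+1) = rshift 1 i by apply/val_inj.
  by rewrite (_ : rV_cons _ _ _ = y ord0 i)//; exact: row_mxEr.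
case: (split_ordP (i : 'I_(1 + n))) => j ->.
  rewrite (_ : rV_cons _ _ _ = t); last first.
    by apply: etrans (row_mxEl _ _ _ _) _; rewrite mxE.
  by rewrite (_ : lshift n j = ord0)//; apply/val_inj; rewrite /= ord1.
rewrite (_ : rV_cons _ _ _ = y ord0 j); last exact: row_mxEr.
by rewrite (_ : rshift 1 j = lift ord0 j)//; apply/val_inj.
Qed.

End lebesgue_rV.

Section geometry.
Context {R : realType} {d : nat}.
Notation point := 'rV[R]_d.
Implicit Types (K S : {fset point}) (A Omega : set point).

Definition dot (x y : point) : R := \sum_i x ord0 i * y ord0 i.

Definition conv K : set point :=
  [set x | exists l : point -> R,
    [/\ forall v, v \in K -> 0 <= l v,
        \sum_(v <- K) l v = 1 &
        x = \sum_(v <- K) l v *: v]].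

Definition affinely_independent K : Prop :=
  forall c : point -> R,
    \sum_(v <- K) c v = 0 -> \sum_(v <- K) c v *: v = 0 ->
    forall v, v \in K -> c v = 0.

Definition barycenter K : point := (#|` K|%:R)^-1 *: \sum_(v <- K) v.

Definition boundary A : set point := closure A `\` interior A.

(* Near every boundary point [x0], for some unit vector [e], the set lies
   strictly above the graph of a Lipschitz function defined on the hyperplane
   orthogonal to [e]: [x - dot x e *: e] is the hyperplane component of [x] and
   [dot x e] its height. *)
Definition lipschitz_boundary Omega : Prop :=
  forall x0, boundary Omega x0 ->
    exists (e : point) (phi : point -> R) (k r : R),
      [/\ dot e e = 1,
          k.-lipschitz_[set y | dot y e = 0] phi,
          0 < r &
          forall x, ball x0 r x ->
            (Omega x <-> phi (x - dot x e *: e) < dot x e)].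

Definition polyhedral Omega : Prop :=
  exists P : {fset {fset point}},
    closure Omega = \bigcup_(K in [set` P]) conv K.

Definition bounded_polyhedral_lipschitz_domain Omega : Prop :=
  [/\ Omega !=set0, open Omega, connected Omega, bounded_set Omega &
      polyhedral Omega /\ lipschitz_boundary Omega].

(* An element is represented by its set of vertices; the element itself is
   [conv K]. The common face [F] in the conformity condition may be empty. *)
Definition regular_triangulation (Th : {fset {fset point}}) Omega : Prop :=
  [/\ forall K, K \in Th -> #|` K| = d.+1 /\ affinely_independent K,
      closure Omega = \bigcup_(K in [set` Th]) conv K &
      forall K1 K2, K1 \in Th -> K2 \in Th ->
        exists F : {fset point},
          [/\ (F `<=` K1)%fset, (F `<=` K2)%fset &
              conv K1 `&` conv K2 = conv F]].

Definition side_of S K : Prop := (S `<=` K)%fset /\ #|` S| = d.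

Definition sides (Th : {fset {fset point}}) : set {fset point} :=
  [set S | exists2 K, K \in Th & side_of S K].

Definition boundary_sides (Th : {fset {fset point}}) Omega :
    set {fset point} :=
  [set S | sides Th S /\ conv S `<=` boundary Omega].

Definition boundary_partition (Th : {fset {fset point}}) Omega
    (GammaD GammaN : set point) : Prop :=
  boundary Omega = GammaD `|` GammaN /\
  exists2 D : set {fset point}, D `<=` boundary_sides Th Omega &
    GammaD = \bigcup_(S in D) conv S /\
    GammaN = \bigcup_(S in boundary_sides Th Omega `\` D) conv S.

End geometry.

(* Elements of [L^oo(Omega)] are represented by Borel functions on the whole
   space ['rV[R]_d], two of which represent the same class when they are equal
   almost everywhere on [Omega]; all the function spaces below are stable under
   this equivalence. *)
Section spaces.
Context {R : realType} {d : nat}.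
Notation point := 'rV[R]_d.
Notation mu := (@lebesgue_rV R d).
Implicit Types (Th : {fset {fset point}}) (Omega GammaD : set point).

Definition Linfty Omega : set (point -> R) :=
  [set v : point -> R | measurable_fun [set: point] v /\
           exists M : R, {ae mu, forall x, Omega x -> `|v x| <= M}].

Definition Pk (k : nat) : set (point -> R) :=
  [set f : point -> R | exists2 p : mpoly.mpoly d R,
     forall m, mpoly.mcoeff m p != 0 -> (mpoly.mdeg m <= k)%N &
     forall x, f x = mpoly.meval (fun i => x ord0 i) p].

(* [q K] is the polynomial that coincides with [v] on the element [K]; it is
   uniquely determined by [v]. *)
Definition piecewise (k : nat) Th (v : point -> R)
    (q : {fset point} -> point -> R) : Prop :=
  forall K, K \in Th -> Pk k (q K) /\ v = q K %[ae mu in conv K].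

Definition broken_Pk (k : nat) Th Omega : set (point -> R) :=
  [set v : point -> R | Linfty Omega v /\ exists q, piecewise k Th v q].

(* Continuity at the barycenter of a side: the polynomials of all elements
   having this side agree there, which is no condition on a boundary side. *)
Definition CR Th Omega : set (point -> R) :=
  [set v : point -> R | Linfty Omega v /\
    exists2 q, piecewise 1 Th v q &
      forall S K1 K2, K1 \in Th -> K2 \in Th -> side_of S K1 -> side_of S K2 ->
        q K1 (barycenter S) = q K2 (barycenter S)].

Definition CR_D Th Omega GammaD : set (point -> R) :=
  [set v : point -> R | CR Th Omega v /\
    exists2 q, piecewise 1 Th v q &
      forall S K, K \in Th -> side_of S K -> conv S `<=` GammaD ->
        q K (barycenter S) = 0].

(* The elementwise means; distinct elements only overlap in a null set. *)
Definition Pi_h Th (v : point -> R) : point -> R := fun x =>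
  \sum_(K <- Th)
    (fine (mu (conv K)))^-1 * (\int[mu]_(y in conv K) v y) * \1_(conv K) x.

Definition Pi_h_image Th Omega (V : set (point -> R)) : set (point -> R) :=
  [set w : point -> R | Linfty Omega w /\
    exists2 v, V v & w = Pi_h Th v %[ae mu in Omega]].

End spaces.

(* The quotient of the subspace [W] by the subspace [U] is spanned by [n]
   vectors, i.e. has dimension at most [n]. *)
Definition codim_le (R : realType) (V : lmodType R) (U W : set V) (n : nat) :
    Prop :=
  [/\ GRing.submod_closed (mem U), GRing.submod_closed (mem W), U `<=` W &
      exists2 b : 'I_n -> V, forall i, W (b i) &
        forall w, W w -> exists2 u, U u &
          exists c : 'I_n -> R, w = u + \sum_(i < n) c i *: b i].

(* Main.v *)
From HB Require Import structures.
Require Import Defs.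
From mathcomp Require Import all_boot all_order all_algebra finmap.
From mathcomp Require Import all_classical all_reals all_analysis.
From mathcomp Require Import measurable_realfun ring lra.
From mathcomp Require Import (canonicals) mpoly.
Set Implicit Arguments.
Unset Strict Implicit.
Unset Printing Implicit Defensive.
Import Order.TTheory GRing.Theory Num.Theory.
Import numFieldNormedType.Exports.
Local Open Scope classical_set_scope.
Local Open Scope ring_scope.

(** The dimension count behind the theorem is a statement about the dual graph
    of the triangulation, whose vertices are the elements and whose edges are the
    sides shared by two elements.

    For a side [S] not contained in the Dirichlet boundary, the Crouzeix-Raviart
    basis function of [S] is [1 - d * lambda] on every element with side [S], where
    [lambda] is the barycentric coordinate of the vertex opposite to [S], and zero
    on the other elements. All barycentric coordinates of a simplex have the mean
    [1 / (d + 1)], hence the projection of the basis function is, up to the factor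
    [1 / (d + 1)], the sum of the indicators of the elements having the side [S]
    ([side_indic_image]). Let [U] be the image of the projection. If two elements
    share [S], the sum of their indicators is in [U] ([shared_side_image]); if [S] is
    a Neumann side, it belongs to one element only, and the indicator of that element
    is in [U] ([neumann_side_image]). The dual graph being connected
    ([strongly_connected]), all indicators agree up to sign modulo [U]: they span a
    quotient of dimension at most one, and they all belong to [U] as soon as there
    is a Neumann side.

    Three facts require work. The dual graph is connected because elements that do
    not share a side meet in faces of codimension two at least, which a generic
    segment avoids. A side shared by two elements is not contained in the boundary,
    because these elements lie on both sides of it and fill a neighbourhood of its
    barycenter ([shared_side_nbhs]), whereas a Lipschitz domain is the interior of its
    closure ([lipschitz_interior_closure]). Finally the barycentric coordinates of a
    simplex have equal means because the affine map exchanging two vertices preserves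
    Lebesgue measure ([mu_swap]): it maps Lebesgue measure to a translation invariant
    measure, hence to a multiple of Lebesgue measure, and it preserves the measure of
    the simplex. *)

Local Notation conv := Defs.conv.

(** * Affine functions *)

Section affine_functions.
Context {R : realType} {d : nat}.
Notation point := 'rV[R]_d.
Implicit Types (f g : point -> R) (x y : point).

Definition affine f := exists (b : R) (a : point), forall x, f x = b + dot a x.

Lemma dotDr (a x y : point) : dot a (x + y) = dot a x + dot a y.
Proof.
by rewrite /dot -big_split; apply: eq_bigr => i _; rewrite mxE mulrDr.
Qed.

Lemma dotZr (c : R) (a x : point) : dot a (c *: x) = c * dot a x.
Proof.
by rewrite /dot mulr_sumr; apply: eq_bigr => i _; rewrite mxE mulrCA.
Qed.

Lemma dotC (a x : point) : dot a x = dot x a.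
Proof. by apply: eq_bigr => i _; rewrite mulrC. Qed.

Lemma dotBr (a x y : point) : dot a (x - y) = dot a x - dot a y.
Proof. by rewrite dotDr -scaleN1r dotZr mulN1r. Qed.

Lemma dot0r (a : point) : dot a 0 = 0.
Proof. by rewrite -(scale0r a) dotZr mul0r. Qed.

Lemma dot_sumr (I : Type) (s : seq I) (a : point) (F : I -> point) :
  dot a (\sum_(i <- s) F i) = \sum_(i <- s) dot a (F i).
Proof. by elim/big_ind2: _ => [|u ? v ? <- <-|//]; rewrite ?dot0r ?dotDr. Qed.

Lemma dot_gt0 (a : point) : a != 0 -> 0 < dot a a.
Proof.
move=> a0; rewrite lt0r sumr_ge0 ?andbT; last by move=> i _; rewrite -expr2 sqr_ge0.
apply: contra a0; rewrite psumr_eq0 => [/allP h|i _]; last by rewrite -expr2 sqr_ge0.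
apply/eqP/rowP => i; rewrite mxE; apply/eqP.
by have := h i (mem_index_enum _); rewrite mulf_eq0 orbb.
Qed.

Lemma affine_cst (c : R) : affine (fun=> c).
Proof. by exists c, 0 => x; rewrite dotC dot0r addr0. Qed.

Lemma affineD f g : affine f -> affine g -> affine (fun x => f x + g x).
Proof.
move=> [b [a fE]] [b' [a' gE]]; exists (b + b'), (a + a') => x.
by rewrite fE gE (dotC (_ + _)) dotDr !(dotC x) addrACA.
Qed.

Lemma affineZ (c : R) f : affine f -> affine (fun x => c * f x).
Proof.
move=> [b [a fE]]; exists (c * b), (c *: a) => x.
by rewrite fE (dotC (_ *: _)) dotZr (dotC x) mulrDr.
Qed.

Lemma affine_sum (I : Type) (s : seq I) (c : I -> R) (v : I -> point) f :
  affine f -> \sum_(i <- s) c i = 1 ->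
  f (\sum_(i <- s) c i *: v i) = \sum_(i <- s) c i * f (v i).
Proof.
move=> [b [a fE]] c1.
rewrite fE dot_sumr -[b]mul1r -c1 mulr_suml -big_split.
by apply: eq_bigr => i _ /=; rewrite fE dotZr mulrDr.
Qed.

Lemma affine_diff f x u v (t : R) : affine f ->
  f (x + t *: (u - v)) = f x + t * (f u - f v).
Proof. by move=> [b [a fE]]; rewrite !fE dotDr dotZr dotBr; ring. Qed.

End affine_functions.

(** * Barycentric coordinates *)

Section barycentric.
Context {R : realType} {d : nat}.
Notation point := 'rV[R]_d.
Implicit Types (K S F : {fset point}) (x y v p : point) (f : point -> R).

Definition simplex K := #|` K| = d.+1 /\ affinely_independent K.

Definition homog x : 'rV[R]_(1 + d) := row_mx (1%:M : 'M[R]_1) x.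

(** The rows are the homogeneous coordinates of the vertices, so that affine
    independence becomes invertibility. *)
Definition vertex_mx K : 'M[R]_(1 + d) := \matrix_(i < 1 + d) homog (nth 0 K i).

(** Solving the linear system for the coefficients gives a total function of
    [x], visibly affine; it is the barycentric coordinate of [x] at [v] when [K] is
    a simplex with vertex [v]. *)
Definition bc K v x : R :=
  (homog x *m invmx (vertex_mx K)) ord0 (inord (index v K)).

Lemma sum_vertices (V : nmodType) K (F : point -> V) : #|` K| = d.+1 ->
  \sum_(v <- K) F v = \sum_(i < 1 + d) F (nth 0 K i).
Proof.
move=> cK; rewrite (big_nth 0) big_mkord.
by have -> : size K = (1 + d)%N by exact: cK.
Qed.

Lemma homog_sum (I : Type) (s : seq I) (c : I -> R) (v : I -> point) :
  \sum_(i <- s) c i *: homog (v i) =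
  row_mx (\sum_(i <- s) c i)%:M (\sum_(i <- s) c i *: v i).
Proof.
elim/big_rec3: _ => [|i y y' z _ ->]; first by rewrite raddf0 row_mx0.
by rewrite /homog scale_row_mx scale_scalar_mx mulr1 add_row_mx raddfD.
Qed.

Lemma vertex_mx_unit K : simplex K -> vertex_mx K \in unitmx.
Proof.
move=> [cK aK]; rewrite -row_free_unit -kermx_eq0; apply/rowV0P => u.
move=> /sub_kermxP; rewrite mulmx_sum_row => u0.
have {u0}: \sum_i u ord0 i *: homog (nth 0 K i) = 0.
  by rewrite -[RHS]u0; apply: eq_bigr => i _; rewrite rowK.
rewrite homog_sum -[X in _ = X]row_mx0 => /eq_row_mx[u1 u2].
pose c v := u ord0 (inord (index v K)).
have cE (i : 'I_(1 + d)) : c (nth 0 K i) = u ord0 i.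
  by rewrite /c index_uniq ?fset_uniq ?inord_val// [X in (_ < X)%N]cK.
have c0 := aK c; rewrite !sum_vertices// in c0.
apply/rowP => i; rewrite -cE mxE; apply: c0.
- under eq_bigr do rewrite cE.
  by move/matrixP/(_ ord0 ord0): u1; rewrite !mxE eqxx mulr1n.
- by under eq_bigr do rewrite cE.
- by apply: mem_nth; rewrite [X in (_ < X)%N]cK.
Qed.

Lemma homog_bc K x : simplex K ->
  homog x = \sum_(v <- K) bc K v x *: homog v.
Proof.
move=> sK; rewrite sum_vertices; last by case: sK.
rewrite -[LHS](mulmxKV (vertex_mx_unit sK)) mulmx_sum_row.
apply: eq_bigr => i _; rewrite rowK /bc index_uniq ?fset_uniq ?inord_val//.
by rewrite [X in (_ < X)%N](proj1 sK).
Qed.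

Lemma bc_sum1 K x : simplex K -> \sum_(v <- K) bc K v x = 1.
Proof.
move=> /(homog_bc x); rewrite homog_sum => /eq_row_mx[+ _].
by move=> /matrixP/(_ ord0 ord0); rewrite !mxE eqxx !mulr1n.
Qed.

Lemma bc_sum K x : simplex K -> \sum_(v <- K) bc K v x *: v = x.
Proof. by move=> /(homog_bc x); rewrite homog_sum => /eq_row_mx[_ <-]. Qed.

Lemma bc_uniq K (c : point -> R) : simplex K -> \sum_(v <- K) c v = 1 ->
  forall v, v \in K -> bc K v (\sum_(u <- K) c u *: u) = c v.
Proof.
move=> sK c1 v vK; set x := \sum_(u <- K) _.
apply/eqP; rewrite -subr_eq0; apply/eqP.
have [_ /(_ (fun v => bc K v x - c v))] := sK; apply => //.
- by rewrite sumrB bc_sum1// c1 subrr.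
- by under eq_bigr do rewrite scalerBl; rewrite sumrB bc_sum// subrr.
Qed.

Lemma bc_affine K v : affine (bc K v).
Proof.
rewrite /bc; set A := invmx _; set j := inord _.
exists (A (lshift d ord0) j), (\row_i A (rshift 1 i) j) => x.
rewrite mxE big_split_ord /= big_ord1; congr (_ + _).
  by rewrite [X in X * _]row_mxEl mxE eqxx mul1r.
by apply: eq_bigr => i _; rewrite [X in X * _]row_mxEr mxE mulrC.
Qed.

Lemma bc_vertex K v u : simplex K -> v \in K -> u \in K ->
  bc K v u = (v == u)%:R.
Proof.
move=> sK vK uK.
have <- := @bc_uniq K (fun w => (w == u)%:R) sK _ v vK; last first.
  by rewrite (bigD1_seq u) ?fset_uniq//= eqxx big1 ?addr0// => w /negbTE->.
congr bc; rewrite (bigD1_seq u) ?fset_uniq//= eqxx scale1r big1 ?addr0//.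
by move=> w /negbTE ->; rewrite scale0r.
Qed.

Lemma affine_bc K f : simplex K -> affine f ->
  forall x, f x = \sum_(v <- K) bc K v x * f v.
Proof. by move=> sK af x; rewrite -{1}(bc_sum x sK) affine_sum ?bc_sum1. Qed.

Lemma convE K : simplex K ->
  conv K = [set x | forall v, v \in K -> 0 <= bc K v x].
Proof.
move=> sK; apply/seteqP; split=> [x [l [l0 l1 ->]] v vK|x h] /=.
  by rewrite bc_uniq ?l0.
by exists (bc K ^~ x); split; [|rewrite bc_sum1|rewrite bc_sum].
Qed.

Lemma affine_conv_eq F f (c : R) : affine f -> (forall v, v \in F -> f v = c) ->
  forall x, conv F x -> f x = c.
Proof.
move=> af fc x [l [_ l1 ->]]; rewrite affine_sum//.
rewrite (eq_big_seq (fun v => l v * c)) => [|v vF]; last by rewrite fc.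
by rewrite -mulr_suml l1 mul1r.
Qed.

Lemma conv_subset K F : simplex K -> (F `<=` K)%fset -> conv F `<=` conv K.
Proof.
move=> sK FK x [l [l0 l1 ->]]; rewrite convE// => v vK.
rewrite affine_sum//; last exact: bc_affine.
rewrite big_seq sumr_ge0// => u uF; rewrite mulr_ge0 ?l0//.
by rewrite bc_vertex ?ler0n// (fsubsetP FK).
Qed.

(** On the face [F] the coordinate is an affine function vanishing at all the
    vertices. *)
Lemma bc_face K F v : simplex K -> v \in K -> v \notin F -> (F `<=` K)%fset ->
  forall x, conv F x -> bc K v x = 0.
Proof.
move=> sK vK vF FK; apply: affine_conv_eq; first exact: bc_affine.
move=> u uF; rewrite bc_vertex//; last exact: (fsubsetP FK).
by case: eqVneq => // vu; rewrite vu uF in vF.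
Qed.

Lemma affine_barycenter S f : affine f -> (0 < #|` S|)%N ->
  f (barycenter S) = (#|` S|%:R)^-1 * \sum_(v <- S) f v.
Proof.
move=> af S0; rewrite /barycenter scaler_sumr affine_sum ?mulr_sumr//.
rewrite big_const_seq count_predT iter_addr addr0 -[X in X *+ _]mulr1 -mulrnAr.
by rewrite mulVf// pnatr_eq0 -lt0n.
Qed.

Lemma bc_barycenter K S v : simplex K -> (S `<=` K)%fset -> v \in K ->
  (0 < #|` S|)%N -> bc K v (barycenter S) = (v \in S)%:R / #|` S|%:R.
Proof.
move=> sK SK vK S0; rewrite affine_barycenter//; last exact: bc_affine.
rewrite mulrC; congr (_ / _).
rewrite (eq_big_seq (fun u => (u == v)%:R)) => [|u uS]; last first.
  by rewrite bc_vertex// ?(fsubsetP SK)// eq_sym.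
case: (boolP (v \in S)) => [vS|vS].
  by rewrite (bigD1_seq v) ?fset_uniq//= eqxx big1 ?addr0// => w /negbTE ->.
rewrite big1_seq// => u /= uS; case: eqVneq => // uv.
by rewrite -uv uS in vS.
Qed.

Lemma side_of_opp K S : #|` K| = d.+1 -> side_of S K ->
  exists p, [/\ p \in K, p \notin S & K = (p |` S)%fset].
Proof.
move=> cK [SK cS].
have : #|` (K `\` S)%fset| = 1%N.
  by rewrite cardfsD (fsetIidPr SK) cK cS subSnn.
move=> /eqP/cardfs1P[p pE]; exists p.
have /fsetDP[pK pS] : p \in (K `\` S)%fset by rewrite pE inE.
split => //; apply/esym/eqP; rewrite eqEfcard; apply/andP; split.
  by apply/fsubsetP => u; rewrite !inE => /orP[/eqP->//|]; exact: (fsubsetP SK).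
by rewrite cK cardfsU1 pS cS.
Qed.

(** Two facets of a simplex that omit the same vertex coincide. *)
Lemma side_of_neq K S S' : #|` K| = d.+1 -> side_of S K -> side_of S' K ->
  forall p, p \in K -> p \notin S -> S' != S -> p \in S'.
Proof.
move=> cK sS [S'K cS'] p pK pS; apply: contra_neqT => pS'.
have [q [qK qS KE]] := side_of_opp cK sS.
have pq : p = q by move: pK; rewrite KE !inE (negbTE pS) orbF => /eqP.
apply/eqP; rewrite eqEfcard (proj2 sS) cS' leqnn andbT.
apply/fsubsetP => u uS'; have := fsubsetP S'K u uS'.
rewrite KE !inE => /orP[/eqP uq|//].
by move: pS'; rewrite pq -uq uS'.
Qed.

End barycentric.

(** * Topology of simplices and of Lipschitz domains *)

Section topology.
Context {R : realType} {d : nat}.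
Notation point := 'rV[R]_d.
Implicit Types (K S F : {fset point}) (x y v p : point) (f : point -> R).
Implicit Types (A B D O N : set point).

Lemma affine_continuous f : affine f -> continuous f.
Proof.
move=> [b [a fE]]; have -> : f = (fun x => b + \sum_i a ord0 i * x ord0 i).
  by apply/funext => x; rewrite fE.
have cs : continuous (fun x : point => \sum_i a ord0 i * x ord0 i).
  apply: (@continuous_big _ _ +%R 0) => [|i _ x]; first exact: add_continuous.
  exact: cvgMl_tmp (@coord_continuous _ _ _ _ _ x).
by move=> x; exact: (cvgD (cvg_cst _) (cs x)).
Qed.

Lemma nbhs_affine_gt0 (s : {fset point}) (f : point -> point -> R) x :
  (forall v, affine (f v)) -> (forall v, v \in s -> 0 < f v x) ->
  nbhs x [set y | forall v, v \in s -> 0 < f v y].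
Proof.
move=> af f0; have : nbhs x (\bigcap_(v in [set` s]) [set y | 0 < f v y]).
  apply: filter_bigI => v vs /=.
  have ac : continuous (f v) by exact: affine_continuous.
  exact: (cvgr_gt _ (ac x) _ (f0 v vs)).
by apply: filterS => y h v vs; exact: h.
Qed.

(** Used to find points close to [x] on a prescribed side of a hyperplane or
    graph through [x]. *)
Lemma nbhs_ray N x u : nbhs x N -> exists t, [/\ 0 < t, t <= 1 & N (x + t *: u)].
Proof.
move=> nN; pose g (t : R) : point := x + t *: u.
have cg : g @ 0^'+ --> x.
  have gc : continuous g.
    have uc : continuous (fun t : R => t *: u) by exact: scalel_continuous.
    by move=> t; exact: (cvgD (cvg_cst x) (uc t)).
  have <- : g 0 = x by rewrite /g scale0r addr0.
  by apply: cvg_at_right_filter; exact: gc.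
have H : \forall t \near 0^'+, N (g t) /\ 0 < t <= 1.
  near=> t; split; first by near: t; exact: cg.
  by apply/andP; split => //; near: t; exact: nbhs_right_le.
by have [t [Nt /andP[t0 t1]]] := @filter_ex _ (at_right 0) _ _ H; exists t.
Unshelve. all: by end_near.
Qed.

Lemma ball_segment x (e : R) a b (t : R) : ball x e a -> ball x e b ->
  0 <= t -> t <= 1 -> ball x e (a + t *: (b - a)).
Proof.
move=> xa xb t0 t1; rewrite -ball_normE /= in xa xb *.
have -> : x - (a + t *: (b - a)) = (1 - t) *: (x - a) + t *: (x - b).
  by apply/rowP => i; rewrite !mxE; ring.
rewrite (le_lt_trans (ler_normD _ _))// !normrZ.
rewrite (ger0_norm t0) ger0_norm ?subr_ge0//.
move: xa xb; set p := `|x - a|; set q := `|x - b|; move=> xa xb.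
have [->|t0'] := eqVneq t 0; first by lra.
have : 0 < t by rewrite lt_neqAle eq_sym t0'.
nra.
Qed.

(** Otherwise the trace of [A] on [E] would be open and closed in [E]. *)
Lemma connected_meet (T : topologicalType) (E A B : set T) :
  connected E -> closed A -> closed B -> E `<=` A `|` B ->
  E `&` A !=set0 -> E `&` B !=set0 -> E `&` A `&` B !=set0.
Proof.
move=> cE cA cB EAB EA [b [Eb Bb]]; apply: contrapT => h.
have EAE : E `&` A = E.
  apply: cE => //.
  - exists (~` B); first exact: closed_openC.
    apply/seteqP; split => z [Ez Az]; split => //.
      by move=> Bz; apply: h; exists z.
    by case: (EAB z Ez).
  - by exists A.
have : (E `&` A) b by rewrite EAE.
by move=> [_ Ab]; apply: h; exists b.
Qed.

(** Each set of the family leaves a smaller open set in which the others can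
    still be avoided. *)
Lemma avoid_nowhere_dense (T : topologicalType) (I : eqType) (s : seq I)
    (Z : I -> set T) :
  (forall i, i \in s -> forall O : set T, open O -> O !=set0 ->
     exists O' : set T, [/\ open O', O' !=set0, O' `<=` O & O' `<=` ~` Z i]) ->
  forall O : set T, open O -> O !=set0 ->
    exists2 x, O x & forall i, i \in s -> ~ Z i x.
Proof.
elim: s => [|i s ih] h O oO nO; first by case: nO => x Ox; exists x.
have [V [oV nV VO VZ]] := h i (mem_head _ _) O oO nO.
have [|x Vx xZ] := ih _ V oV nV.
  by move=> j js; apply: h; rewrite inE js orbT.
exists x; first exact: VO.
by move=> j; rewrite inE => /orP[/eqP->|]; [exact: VZ|exact: xZ].
Qed.

Lemma hyperplane_nowhere_dense (l a : point) O : l != 0 -> open O -> O !=set0 ->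
  exists O', [/\ open O', O' !=set0, O' `<=` O &
                 O' `<=` [set b | dot l (b - a) != 0]].
Proof.
move=> l0 oO [x Ox]; pose f b := dot l (b - a).
have af : affine f by exists (- dot l a), l => b; rewrite /f dotBr addrC.
exists (O `&` f @^-1` [set y | y != 0]); split.
- apply: openI => //; apply: open_comp => [y _|]; last exact: open_neq.
  exact: affine_continuous.
- have [fx|fx] := eqVneq (f x) 0; last by exists x.
  have [t [t0 _ Ot]] := nbhs_ray l (open_nbhs_nbhs (conj oO Ox)).
  exists (x + t *: l); split => //=.
  rewrite /f addrAC dotDr dotZr -/(f x) fx add0r mulf_neq0// gt_eqF//.
  exact: dot_gt0.
- by move=> ? [].
- by move=> y [].
Qed.

(** A system of fewer than [d] linear equations has a nonzero solution. *)
Lemma orthogonal_to_few (s : seq point) : (size s < d)%N ->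
  exists2 l : point, l != 0 & forall u, u \in s -> dot l u = 0.
Proof.
move=> sd; pose M : 'M[R]_(d, size s) := \matrix_(i, j) nth 0 s j ord0 i.
have : kermx M != 0.
  rewrite kermx_eq0 /row_free neq_ltn (leq_ltn_trans (rank_leq_col _))//.
move=> /rowV0Pn[l /sub_kermxP lM l0]; exists l => // u us.
have us' : (index u s < size s)%N by rewrite index_mem.
move/rowP/(_ (Ordinal us')) : lM; rewrite !mxE => <-.
by apply: eq_bigr => i _; rewrite mxE nth_index.
Qed.

Definition open_simplex K := [set x | forall v, v \in K -> 0 < bc K v x].

Lemma open_simplex_open K : open (open_simplex K).
Proof.
rewrite openE => x xK; apply: nbhs_affine_gt0 => // v; exact: bc_affine.
Qed.

Lemma open_simplex_conv K : simplex K -> open_simplex K `<=` conv K.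
Proof. by move=> sK x xK; rewrite convE// => v vK; rewrite ltW// xK. Qed.

Lemma barycenter_open_simplex K : simplex K -> open_simplex K (barycenter K).
Proof.
move=> sK v vK; have [cK _] := sK.
rewrite bc_barycenter ?fsubset_refl ?cK//.
by rewrite vK divr_gt0// ltr0n.
Qed.

Lemma barycenter_conv S : (0 < #|` S|)%N -> conv S (barycenter S).
Proof.
move=> S0; exists (fun=> (#|` S|%:R)^-1); split.
- by move=> v _; rewrite invr_ge0 ler0n.
- rewrite big_const_seq count_predT iter_addr addr0 -[X in X *+ _]mulr1 -mulrnAr.
  by rewrite mulVf// pnatr_eq0 -lt0n.
- by rewrite /barycenter scaler_sumr.
Qed.

(** Points move inside the simplex on their way to its barycenter. *)
Lemma open_simplex_near K x N : simplex K -> conv K x -> nbhs x N ->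
  exists2 a, open_simplex K a & N a.
Proof.
move=> sK Kx /(nbhs_ray (barycenter K - x))[t [t0 t1 Nt]].
exists (x + t *: (barycenter K - x)) => // v vK.
rewrite affine_diff; last exact: bc_affine.
have := barycenter_open_simplex sK vK.
move: Kx; rewrite convE// => /(_ v vK).
move: (bc K v x) (bc K v (barycenter K)) => p q p0 q0.
by rewrite [X in 0 < X](_ : _ = (1 - t) * p + t * q); [nra|ring].
Qed.

Lemma conv_closed K : simplex K -> closed (conv K).
Proof.
move=> sK; rewrite convE//.
have -> : [set x | forall v, v \in K -> 0 <= bc K v x] =
    \bigcap_(v in [set` K]) (bc K v @^-1` [set y | 0 <= y]).
  by apply/seteqP; split => x h v; exact: h.
apply: closed_bigI => v _; apply: preimage_closed; last exact: closed_ge.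
by move=> x _; exact: affine_continuous (@bc_affine _ _ K v) x.
Qed.

(** Near a boundary point the points strictly below the graph form an open set
    disjoint from the domain, so that no boundary point is interior to the closure.
    This excludes domains with slits. *)
Lemma lipschitz_interior_closure (Omega : set point) :
  open Omega -> lipschitz_boundary Omega ->
  interior (closure Omega) `<=` Omega.
Proof.
move=> oO lO x0 ix0; apply: contrapT => nx0.
have [|e [phi [k [r [ee phiL r0 hr]]]]] := lO x0.
  by split; [exact: interior_subset|move=> /interior_subset].
pose h z := z - dot z e *: e.
have hh z : dot (h z) e = 0.
  by rewrite /h dotC dotBr dotZr ee mulr1 dotC subrr.
have gex : dot x0 e <= phi (h x0).
  rewrite leNgt; apply/negP => lt0; apply: nx0; apply/hr => //.
  exact: ballxx.
(* a point below the graph, still interior to the closure *)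
have [t [t0 _ [Nt1 Nt2]]] := @nbhs_ray (ball x0 r `&` interior (closure Omega))
  x0 (- e) (filterI (nbhsx_ballx _ _ r0) (nbhs_interior ix0)).
set y := x0 + _ in Nt1 Nt2.
have ye : dot y e = dot x0 e - t.
  by rewrite /y dotC dotDr dotZr -scaleN1r dotZr ee mulr1 mulrN1 dotC.
have hy : h y = h x0.
  rewrite /h ye /y scalerBl scalerN opprB; apply/rowP => i; rewrite !mxE; ring.
pose g z := phi (h y) - k * `|h z - h y| - dot z e.
have gy : 0 < g y by rewrite /g subrr normr0 mulr0 subr0 ye hy; lra.
have cg : continuous g.
  have cd : continuous (fun z : point => dot z e).
    by apply: affine_continuous; exists 0, e => z; rewrite add0r dotC.
  have ce : continuous (fun z : point => dot z e *: e).
    by move=> z; exact: (cvgZr_tmp (cd z)).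
  have ch : continuous h.
    have ci : continuous (fun z : point => z) by move=> z; exact: cvg_id.
    by move=> z; exact: (cvgB (ci z) (ce z)).
  have chc : continuous (fun z => h z - h y).
    by move=> z; exact: (cvgB (ch z) (cvg_cst _)).
  have cn : continuous (fun z => `|h z - h y|).
    by move=> z; exact: (cvg_norm (chc z)).
  have ck : continuous (fun z => k * `|h z - h y|).
    by move=> z; exact: (cvgMl_tmp (cn z)).
  have cp : continuous (fun z => phi (h y) - k * `|h z - h y|).
    by move=> z; exact: (cvgB (cvg_cst _) (ck z)).
  by move=> z; exact: (cvgB (cp z) (cd z)).
have ny : nbhs y [set z | 0 < g z] by exact: (cvgr_gt _ (cg y) _ gy).
have nyr : nbhs y (ball x0 r).
  by apply: open_nbhs_nbhs; split => //; exact: ball_open.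
have [z [Oz [gz rz]]] := interior_subset Nt2 _ (filterI ny nyr).
have := (hr z rz).1 Oz; apply/negP; rewrite -leNgt.
have hL : `|phi (h z) - phi (h y)| <= k * `|h z - h y|.
  by apply: (phiL (h z, h y)); split => /=; exact: hh.
move: gz hL; rewrite /g /= -/(h z) => gz; rewrite ler_norml => /andP[hL _].
lra.
Qed.

End topology.

(** * Conforming triangulations *)

Section triangulation.
Context {R : realType} {d : nat} (Omega : set 'rV[R]_d).
Context (Th : {fset {fset 'rV[R]_d}}).
Hypothesis hTh : regular_triangulation Th Omega.
Notation point := 'rV[R]_d.
Implicit Types (K S F : {fset point}) (x y v p : point) (f : point -> R).

Lemma tri_simplex K : K \in Th -> simplex K.
Proof. by case: hTh => h _ _; exact: h. Qed.

Lemma tri_closure K : K \in Th -> conv K `<=` closure Omega.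
Proof. by case: hTh => _ -> _ KT x Kx; exists K. Qed.

Lemma tri_cover x : Omega x -> exists2 K, K \in Th & conv K x.
Proof.
move=> /subset_closure; case: hTh => _ -> _ [K KT Kx]; by exists K.
Qed.

(** The common face is spanned by common vertices, hence lies in the face of
    [K] opposite to [v]. *)
Lemma tri_meet K K' v x : K \in Th -> K' \in Th -> v \in K -> v \notin K' ->
  conv K x -> conv K' x -> bc K v x = 0.
Proof.
move=> KT KT' vK vK' Kx Kx'; have [_ _ hF] := hTh.
have [F [FK FK' FE]] := hF K K' KT KT'.
have Fx : conv F x by rewrite -FE.
apply: (bc_face (tri_simplex KT) vK) FK _ Fx.
by apply: contra vK'; exact: (fsubsetP FK').
Qed.

Lemma tri_vertex_notin K K' : K \in Th -> K' \in Th -> K != K' ->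
  exists2 v, v \in K & v \notin K'.
Proof.
move=> KT KT' KK'; apply: contrapT => h.
have [cK _] := tri_simplex KT; have [cK' _] := tri_simplex KT'.
move/eqP: KK'; apply; apply/eqP; rewrite eqEfcard cK cK' leqnn andbT.
apply/fsubsetP => v vK; apply/negPn/negP => vK'; by apply: h; exists v.
Qed.

Lemma open_simplex_notin K K' x : K \in Th -> K' \in Th -> K != K' ->
  open_simplex K x -> ~ conv K' x.
Proof.
move=> KT KT' KK' Kx K'x; have [v vK vK'] := tri_vertex_notin KT KT' KK'.
have := Kx v vK; rewrite (tri_meet KT KT' vK vK' _ K'x) ?ltxx//.
exact: open_simplex_conv (tri_simplex KT) _ Kx.
Qed.

(** Near the barycenter of [S] the coordinates at the vertices of [S] stay
    positive, hence only the sign of the remaining coordinate decides about membership in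
    an element. The remaining coordinates of [K] and [K'] vanish on [S], so they are
    proportional, and a positive ratio would make the elements overlap. *)
Lemma shared_side_nbhs K K' S : (0 < d)%N -> K \in Th -> K' \in Th -> K != K' ->
  side_of S K -> side_of S K' ->
  nbhs (barycenter S) (conv K `|` conv K').
Proof.
move=> d0 KT KT' KK' sS sS'.
have sK := tri_simplex KT; have sK' := tri_simplex KT'.
have [p [pK pS KE]] := side_of_opp (proj1 sK) sS.
have [q [qK qS KE']] := side_of_opp (proj1 sK') sS'.
have [SK cS] := sS; have [SK' _] := sS'.
have S0 : (0 < #|` S|)%N by rewrite cS.
have pK' : p \notin K'.
  apply/negP => pK'; move/eqP: KK'; apply; apply/eqP.
  rewrite eqEfcard (proj1 sK) (proj1 sK') leqnn andbT KE.
  by apply/fsubsetP => u; rewrite !inE => /orP[/eqP->//|]; exact: (fsubsetP SK').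
(* both sides are affine, vanish on [S] and agree at [p] *)
have qE x : bc K' q x = bc K p x * bc K' q p.
  rewrite (affine_bc sK (@bc_affine _ _ K' q)) KE big_fsetU1//= big1_seq ?addr0//.
  move=> u /= uS; rewrite (bc_vertex sK' qK (fsubsetP SK' _ uS)).
  by case: eqVneq => [qu|]; rewrite ?mulr0//; rewrite qu uS in qS.
have N K1 : K1 \in Th -> side_of S K1 ->
    nbhs (barycenter S) [set y | forall v, v \in S -> 0 < bc K1 v y].
  move=> KT1 [SK1 _]; apply: nbhs_affine_gt0 => v; first exact: bc_affine.
  move=> vS; rewrite bc_barycenter//; first by rewrite vS divr_gt0 ?ltr0n.
  - exact: tri_simplex.
  - exact: (fsubsetP SK1).
have inK y : (forall v, v \in S -> 0 < bc K v y) -> 0 <= bc K p y -> conv K y.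
  move=> h hp; rewrite convE// => v; rewrite {1}KE !inE.
  by move=> /orP[/eqP->//|/h/ltW].
have inK' y : (forall v, v \in S -> 0 < bc K' v y) -> 0 <= bc K' q y -> conv K' y.
  move=> h hq; rewrite convE// => v; rewrite {1}KE' !inE.
  by move=> /orP[/eqP->//|/h/ltW].
(* a positive ratio puts the points just above [S] into both elements *)
have c_le0 : bc K' q p <= 0.
  rewrite leNgt; apply/negP => c0.
  have [t [t0 t1 [Nt Nt']]] :=
    nbhs_ray (p - barycenter S) (filterI (N K KT sS) (N K' KT' sS')).
  set y := _ + _ in Nt Nt'.
  have yp : bc K p y = t.
    rewrite affine_diff; last exact: bc_affine.
    rewrite bc_barycenter// (negbTE pS) mul0r subr0 add0r bc_vertex// eqxx.
    exact: mulr1.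
  have Ky : conv K y by apply: inK => //; rewrite yp ltW.
  have Ky' : conv K' y by apply: inK' => //; rewrite qE yp mulr_ge0// ltW.
  have := tri_meet KT KT' pK pK' Ky Ky'; rewrite yp => t00.
  by rewrite t00 ltxx in t0.
apply: filterS (filterI (N K KT sS) (N K' KT' sS')) => y [h h'].
have [yp|yp] := leP 0 (bc K p y); first by left; exact: inK.
right; apply: inK' => //; rewrite qE; exact: mulr_le0 (ltW yp) c_le0.
Qed.

(** The interior of a third element having this side would reach into the
    neighbourhood of the barycenter that is already covered by two elements. *)
Lemma side_at_most_two K K' K'' S : (0 < d)%N ->
  K \in Th -> K' \in Th -> K'' \in Th -> K != K' ->
  side_of S K -> side_of S K' -> side_of S K'' -> K'' = K \/ K'' = K'.
Proof.
move=> d0 KT KT' KT'' KK' sS sS' sS''.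
have N := shared_side_nbhs d0 KT KT' KK' sS sS'.
have [->|K1] := eqVneq K'' K; first by left.
have [->|K2] := eqVneq K'' K'; first by right.
have sK := tri_simplex KT''; have [SK cS] := sS''.
have Sx : conv K'' (barycenter S).
  by apply: (conv_subset sK SK); apply: barycenter_conv; rewrite cS.
have [y Ky [Ky1|Ky1]] := open_simplex_near sK Sx N.
  by case: (open_simplex_notin KT'' KT K1 Ky).
by case: (open_simplex_notin KT'' KT' K2 Ky).
Qed.

Lemma shared_side_interior K K' S : (0 < d)%N -> open Omega ->
  lipschitz_boundary Omega -> K \in Th -> K' \in Th -> K != K' ->
  side_of S K -> side_of S K' -> ~ conv S `<=` boundary Omega.
Proof.
move=> d0 oO lO KT KT' KK' sS sS' h.
have N := shared_side_nbhs d0 KT KT' KK' sS sS'.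
have [_] := h _ (barycenter_conv (S := S) ltac:(by rewrite (proj2 sS))).
rewrite (proj1 (interior_id _) oO); apply; apply: lipschitz_interior_closure => //.
apply: filterS N => y [] ; exact: tri_closure.
Qed.

(** A face with fewer than [d] vertices lies, together with [a], in a hyperplane
    through [a], which contains every line through [a] that meets the face away from
    [a]. *)
Lemma small_face_nowhere_dense K K' (a : point) (O : set point) :
  K \in Th -> K' \in Th -> (#|` (K `&` K')%fset| < d)%N -> ~ conv K' a ->
  open O -> O !=set0 ->
  exists O', [/\ open O', O' !=set0, O' `<=` O &
    O' `<=` ~` [set b | exists t : R, (conv K `&` conv K') (a + t *: (b - a))]].
Proof.
move=> KT KT' cF aK' oO nO; have [_ _ hF] := hTh.
have [F [FK FK' FE]] := hF K K' KT KT'.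
have cFd : (size [seq (v - a : point)%R | v : point <- F] < d)%N.
  rewrite size_map; apply: (leq_ltn_trans _ cF); apply: fsubset_leq_card.
  by apply/fsubsetP => v vF; rewrite inE (fsubsetP FK)// (fsubsetP FK').
have [l l0 lF] := orthogonal_to_few cFd.
have [V [oV nV VO Vl]] := hyperplane_nowhere_dense a l0 oO nO.
exists V; split => // b Vb [t ht].
have Fx : conv F (a + t *: (b - a)) by rewrite -FE.
have : dot l (a + t *: (b - a)) = dot l a.
  apply: affine_conv_eq Fx; first by exists 0, l => x; rewrite add0r.
  move=> v vF; apply/eqP; rewrite -subr_eq0 -dotBr lF//.
  by apply/mapP; exists v.
rewrite dotDr dotZr => /(congr1 (fun z => z - dot l a)).
rewrite addrAC subrr add0r => /eqP; rewrite mulf_eq0 (negbTE (Vl b Vb)) orbF.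
by move=> /eqP t0; apply: aK'; case: ht => _; rewrite t0 scale0r addr0.
Qed.

(** Otherwise the elements satisfying [P] and the other ones would cover [Omega]
    by two closed sets meeting inside [Omega] in faces with fewer than [d] vertices only.
    Near a common point, a segment from the interior of an element of the first kind to
    a generic point of an element of the second kind avoids these faces, although it is
    connected. *)
Lemma strongly_connected (P : set {fset point}) K0 :
  open Omega -> connected Omega ->
  (forall K K' S, K \in Th -> K' \in Th -> side_of S K -> side_of S K' ->
     P K -> P K') ->
  K0 \in Th -> P K0 -> forall K, K \in Th -> P K.
Proof.
move=> oO cO hP KT0 P0 K1 KT1; apply: contrapT => P1.
pose U Q := \bigcup_(K in [set K | K \in Th /\ Q K]) conv K.
have cU Q : closed (U Q).
  apply: closed_bigcup => [|K [KT _]]; last exact: conv_closed (tri_simplex KT).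
  by apply: sub_finite_set (finite_fset Th) => K [].
have OU : Omega `<=` U P `|` U (~` P).
  move=> x /tri_cover[K KT Kx].
  by have [PK|PK] := pselect (P K); [left|right]; exists K.
have meetO (Q : set {fset point}) K : K \in Th -> Q K -> Omega `&` U Q !=set0.
  move=> KT QK; have sK := tri_simplex KT.
  have [x [Ox Kx]] : (Omega `&` open_simplex K) !=set0.
    have bK := barycenter_open_simplex sK.
    apply: (tri_closure KT (open_simplex_conv sK bK)).
    by apply: open_nbhs_nbhs; split => //; exact: open_simplex_open.
  by exists x; split => //; exists K => //; exact: open_simplex_conv.
have [x [[Ox [K [KT PK] Kx]] [K' [KT' PK'] Kx']]] :=
  connected_meet cO (cU P) (cU (~` P)) OU (meetO P K0 KT0 P0)
    (meetO (~` P) K1 KT1 P1).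
have /nbhs_ballP[e /= e0 be] : nbhs x Omega by exact: open_nbhs_nbhs.
have [a Ka xa] := open_simplex_near (tri_simplex KT) Kx (nbhsx_ballx x e e0).
have PneQ K2 K2' : P K2 -> (~` P) K2' -> K2 != K2'.
  by move=> PK2 PK2'; apply/eqP => KK; apply: PK2'; rewrite -KK.
have aU K2 : K2 \in Th -> ~ P K2 -> ~ conv K2 a.
  move=> KT2 PK2; apply: (open_simplex_notin KT KT2) Ka; exact: PneQ.
(* the faces to be avoided: those between the two kinds of elements *)
pose s := [seq (L, L') | L <- [seq L <- Th | `[< P L >]],
                        L' <- [seq L <- Th | ~~ `[< P L >]]].
pose Z (i : {fset point} * {fset point}) :=
  [set b : point | exists t : R, (conv i.1 `&` conv i.2) (a + t *: (b - a))].
have [| | |b [Kb xb] bZ] := @avoid_nowhere_dense point _ s Z _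
    (open_simplex K' `&` ball x e).
- move=> i /allpairsP[[L L'] /= [+ + ->]].
  rewrite !mem_filter => /andP[/asboolP PL LT] /andP[/asboolP PL' LT'] O opO nO.
  apply: small_face_nowhere_dense => //; last exact: aU.
  rewrite ltnNge; apply/negP => cLL; apply: (PL').
  (* [d] common vertices would form a shared side *)
  have cLL' : #|` (L `&` L')%fset| = d.
    apply/eqP; rewrite eqn_leq cLL andbT -ltnS -(proj1 (tri_simplex LT)).
    apply: fproper_ltn_card; rewrite fproperEneq fsubsetIl andbT.
    apply/eqP => LL; have [v vL] := tri_vertex_notin LT LT' (PneQ L L' PL PL').
    by move: vL; rewrite -LL inE => /andP[_ ->].
  apply: (hP L L' (L `&` L')%fset) => //; split => //.
    exact: fsubsetIl.
  exact: fsubsetIr.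
- by apply: openI; [exact: open_simplex_open|exact: ball_open].
- have [b Kb xb] := open_simplex_near (tri_simplex KT') Kx' (nbhsx_ballx x e e0).
  by exists b.
pose g (t : R) := a + t *: (b - a).
have g0 : g 0 = a by rewrite /g scale0r addr0.
have g1 : g 1 = b by rewrite /g scale1r addrC subrK.
have cg : continuous g.
  have gc : continuous (fun t : R => t *: (b - a)) by exact: scalel_continuous.
  by move=> t; exact: (cvgD (cvg_cst a) (gc t)).
have g_xe t : 0 <= t -> t <= 1 -> ball x e (g t) by exact: ball_segment.
have [||||z [[[t t01 <-] [L [LT PL] Lz]] [L' [LT' PL'] Lz']]] :=
  @connected_meet _ (g @` `[0, 1]) (U P) (U (~` P)) _ (cU P) (cU (~` P)).
- apply: connected_continuous_connected; first exact: segment_connected.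
  exact: continuous_subspaceT.
- move=> z [t /=]; rewrite in_itv /= => /andP[t0 t1] <-.
  by apply: OU; apply: be; exact: g_xe.
- exists a; split; first by exists 0; rewrite ?g0 /= ?in_itv /= ?lexx ?ler01.
  exists K => //; exact: open_simplex_conv (tri_simplex KT) _ Ka.
- exists b; split.
    by exists 1; rewrite ?g1 /= ?in_itv /= ?lexx ?ler01.
  exists K' => //; exact: open_simplex_conv (tri_simplex KT') _ Kb.
apply: (bZ (L, L')); last by exists t.
apply/allpairsP; exists (L, L'); split => //=; rewrite mem_filter ?LT ?LT' andbT.
  exact/asboolP.
exact/asboolP.
Qed.

End triangulation.

(** * Translation invariance of Lebesgue measure *)

Section lebesgue.
Context {R : realType}.

Lemma lebesgue_measure_shift (t : R) (A : set R) : measurable A ->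
  lebesgue_measure ((fun x : R => x + t) @^-1` A) = lebesgue_measure A.
Proof.
move=> mA.
have mt : measurable_fun [set: R] (fun x : R => x + t : measurableTypeR R).
  by apply: measurable_funD.
apply/esym; apply: (@lebesgue_measure_unique R
  (measure_function_pushforward__canonical__measure_function_Measure
     lebesgue_measure mt)) => // _ [[a b]] _ <-; rewrite /= /pushforward.
have -> : (fun x => x + t) @^-1` `]a, b]%classic = `]a - t, b - t]%classic.
  by apply/seteqP; split=> x /=; rewrite !in_itv /= ltrBlDr lerBrDr.
by rewrite !lebesgue_measure_itv/= !lte_fin ltrD2r -!EFinB opprB addrA subrK.
Qed.

Context {d : nat}.
Notation point := 'rV[R]_d.
Notation mu := (@lebesgue_rV R d).

Definition boxes : set (set point) :=
  [set B | exists2 A : 'I_d -> set R, (forall i, measurable (A i)) &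
                 B = [set x : point | forall i, A i (x ord0 i)]].

(** Boxes form the intersection-stable generating family on which the measure
    is known by [lebesgue_rV_box]. *)
Lemma boxes_generate : measurable = <<s boxes >>.
Proof.
apply/seteqP; split; last first.
  apply: smallest_sub; first exact: sigma_algebra_measurable.
  by move=> B [A mA ->]; exact: measurable_box.
apply: smallest_sub; first exact: smallest_sigma_algebra.
rewrite -bigcup_seq => B [i _] [C mC <-] /=; apply: sub_gen_smallest.
exists (fun j => if j == i then C else setT); first by move=> j; case: ifP.
apply/seteqP; split => [x [_ Cx] j|x h]; first by case: eqP => // ->.
by split => //; have := h i; rewrite eqxx.
Qed.

Lemma boxes_setI : setI_closed boxes.
Proof.
move=> _ _ [A mA ->] [B mB ->]; exists (fun i => A i `&` B i).
  by move=> i; exact: measurableI.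
apply/seteqP; split => [x [hA hB] i|x h]; first by split.
by split => i; have [] := h i.
Qed.

Definition cube (a : point) (e : R) : set point :=
  [set x | forall i, `[a ord0 i - e, a ord0 i + e]%classic (x ord0 i)].

Lemma cube_box a e : boxes (cube a e).
Proof.
by exists (fun i => `[a ord0 i - e, a ord0 i + e]%classic).
Qed.

Lemma measurable_cube a e : measurable (cube a e).
Proof.
exact: (@measurable_box _ _ (fun i => `[a ord0 i - e, a ord0 i + e]%classic)).
Qed.

Lemma cubeE a e x : cube a e x <-> forall i, `|x ord0 i - a ord0 i| <= e.
Proof.
by split => h i; have := h i; rewrite /= in_itv /= ler_distl.
Qed.

Lemma mu_cube a e : 0 < e -> mu (cube a e) = ((e + e) ^+ d)%:E.
Proof.
move=> e0; rewrite /cube (@lebesgue_rV_box R d (fun i => `[a ord0 i - e, a ord0 i + e]%classic))//.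
rewrite (eq_bigr (fun=> (e + e)%:E)); last first.
  move=> i _; rewrite lebesgue_measure_itv/= lte_fin ifT; last by lra.
  by rewrite -EFinB; congr EFin; lra.
by rewrite prodEFin prodr_const card_ord.
Qed.

Lemma cube_cover : \bigcup_k cube 0 k.+1%:R = [set: point].
Proof.
apply/seteqP; split => // x _.
exists (Num.truncn (\sum_i `|x ord0 i|)) => //; apply/cubeE => i.
rewrite mxE subr0; apply: le_trans (ltW (truncnS_gt _)).
by rewrite (bigD1 i)//= lerDl sumr_ge0.
Qed.

Definition translation_invariant (m : set point -> \bar R) :=
  forall (t : point) A, measurable A -> m ((fun x => x + t) @^-1` A) = m A.

Lemma measurable_shift (t : point) : measurable_fun [set: point] (fun x => x + t).
Proof.
apply: measurable_fun_rV => i.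
have -> : (fun x : point => (x + t) ord0 i) = (fun x => x ord0 i + t ord0 i).
  by apply/funext => x; rewrite mxE.
by apply: measurable_funD => //; exact: measurable_coord.
Qed.

Lemma measurable_preimage (phi : point -> point) A :
  measurable_fun [set: point] phi -> measurable A -> measurable (phi @^-1` A).
Proof. by move=> mphi mA; rewrite -[X in measurable X]setTI; exact: mphi. Qed.

Lemma mu_translation : translation_invariant mu.
Proof.
move=> t A mA.
apply/esym; apply: (@measure_unique _ R point boxes (fun k => cube 0 k.+1%:R)
  boxes_generate boxes_setI (fun=> cube_box _ _) cube_cover mu
  (measure_function_pushforward__canonical__measure_function_Measure
     mu (measurable_shift t))) => // [_ [B mB ->]|k]; last by rewrite mu_cube// ltry.
rewrite /= /pushforward (lebesgue_rV_box mB).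
have -> : (fun x : point => x + t) @^-1` [set x | forall i, B i (x ord0 i)] =
    [set x | forall i, ((fun r => r + t ord0 i) @^-1` B i) (x ord0 i)].
  by apply/seteqP; split => x h i; have := h i; rewrite /= mxE.
rewrite (@lebesgue_rV_box R d (fun i => (fun r => r + t ord0 i) @^-1` B i)).
  by apply: eq_bigr => i _; rewrite lebesgue_measure_shift.
move=> i; rewrite -[X in measurable X]setTI.
by apply: (measurable_funD (@measurable_id _ _ _) (measurable_cst _)) => //.
Qed.

Lemma mu_sigma_finite : sigma_finite [set: point] mu.
Proof.
exists (fun k => cube 0 k.+1%:R); first by rewrite cube_cover.
by move=> k; split; [exact: measurable_cube|rewrite mu_cube// ltry].
Qed.

Lemma fubini_sections (m1 m2 : {sigma_finite_measure set point -> \bar R})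
    (C : set (point * point)) : measurable C ->
  (\int[m1]_x m2 [set y | C (x, y)] = \int[m2]_y m1 [set x | C (x, y)])%E.
Proof.
move=> mC.
have : ((m1 \x m2) C = (m1 \x^ m2) C)%E.
  by apply: product_measure_unique => // A B mA mB /=; rewrite product_measure2E.
congr (_ = _); apply: eq_integral => x _ /=; congr (_ _); apply/seteqP.
  by split => y; rewrite /xsection /= inE.
by split => y; rewrite /ysection /= inE.
Qed.

Lemma integral_cond_cst (m : {measure set point -> \bar R}) (A : set point)
    (c : \bar R) : measurable A ->
  (\int[m]_x (if x \in A then c else 0) = c * m A)%E.
Proof.
move=> mA; rewrite -integral_cst// integral_mkcond.
by apply: eq_integral => x _; rewrite patchE.
Qed.

Lemma measurable_rV_addr : measurable_fun [set: point * point] (fun z => z.1 + z.2).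
Proof.
apply: measurable_fun_rV => i.
have -> : (fun z : point * point => (z.1 + z.2) ord0 i) =
    (fun z => z.1 ord0 i + z.2 ord0 i) by apply/funext => z; rewrite mxE.
by apply: measurable_funD;
  apply: (measurableT_comp (@measurable_coord _ _ d i)) => //.
Qed.

Lemma measurable_rV_subr : measurable_fun [set: point * point] (fun z => z.1 - z.2).
Proof.
apply: measurable_fun_rV => i.
have -> : (fun z : point * point => (z.1 - z.2) ord0 i) =
    (fun z => z.1 ord0 i - z.2 ord0 i) by apply/funext => z; rewrite !mxE.
by apply: measurable_funB;
  apply: (measurableT_comp (@measurable_coord _ _ d i)) => //.
Qed.

Lemma measurable_rV_opp (A : set point) : measurable A -> measurable (-%R @^-1` A).
Proof.
move=> mA; apply: measurable_preimage => //; apply: measurable_fun_rV => i.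
have -> : (fun z : point => (- z) ord0 i) = (fun z => - z ord0 i).
  by apply/funext => z; rewrite !mxE.
by apply: measurable_funN; exact: measurable_coord.
Qed.

(** Both sides measure the pairs [(x, y)] with [x] in [A] and [x + y] in [B]:
    Fubini's theorem is applied before and after the translation of [x] by [y]. *)
Lemma translation_invariant_unique
    (m1 m2 : {sigma_finite_measure set point -> \bar R}) (A B : set point) :
  translation_invariant m1 -> translation_invariant m2 ->
  measurable A -> measurable B ->
  (m1 A * m2 B = m1 B * m2 (-%R @^-1` A))%E.
Proof.
move=> t1 t2 mA mB.
(* the image of [C1] under the substitution of [x - y] for [x] is [C2] *)
pose C1 := [set z : point * point | A z.1 /\ B (z.1 + z.2)].
pose C2 := [set z : point * point | A (z.1 - z.2) /\ B z.1].
have mC1 : measurable C1.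
  apply: measurableI.
    by rewrite -[X in measurable X]setTI; exact: measurable_fst.
  by rewrite -[X in measurable X]setTI; exact: measurable_rV_addr.
have mC2 : measurable C2.
  apply: measurableI.
    by rewrite -[X in measurable X]setTI; exact: measurable_rV_subr.
  by rewrite -[X in measurable X]setTI; exact: measurable_fst.
transitivity (\int[m1]_x m2 [set y | C1 (x, y)])%E.
  rewrite muleC -(integral_cond_cst _ _ mA); apply: eq_integral => x _.
  case: ifPn => [/set_mem Ax|/negP Ax].
    rewrite -(t2 x B mB); congr (m2 _); apply/seteqP.
    by split => y; rewrite /C1 /= addrC; [|case].
  rewrite (_ : [set _ | _] = set0) ?measure0//; apply/seteqP; split => // y [Ax' _].
  by apply: Ax; exact: mem_set.
rewrite fubini_sections//.
transitivity (\int[m2]_y m1 [set x | C2 (x, y)])%E.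
  apply: eq_integral => y _; rewrite -(t1 y [set x | C2 (x, y)]).
    congr (m1 _); apply/seteqP.
    by split => x; rewrite /C1 /C2 /= addrK.
  exact: (measurableI _ _ (measurable_preimage (measurable_shift (- y)) mA) mB).
rewrite -fubini_sections// muleC -(integral_cond_cst _ _ mB).
apply: eq_integral => x _.
case: ifPn => [/set_mem Bx|/negP Bx].
  rewrite -(t2 (- x) _ (measurable_rV_opp mA)).
  congr (m2 _); apply/seteqP.
  by split => y; rewrite /C2 /= opprD opprK addrC; [case|].
rewrite (_ : [set _ | _] = set0) ?measure0//; apply/seteqP; split => // y [_ Bx'].
by apply: Bx; exact: mem_set.
Qed.

Lemma sigma_finite_measure_of (m : {measure set point -> \bar R}) :
  sigma_finite [set: point] m ->
  exists m' : {sigma_finite_measure set point -> \bar R},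
    m' = m :> (set point -> \bar R).
Proof.
move=> sm.
pose H1 := isSFinite.Build _ _ _ _ (sfinite_measure_sigma_finite sm).
pose H2 := isSigmaFinite.Build _ _ _ _ sm.
pose m' := HB.pack_for (SigmaFiniteMeasure.type point R) (Measure.sort m) H1 H2.
by exists m'.
Qed.

(** The image measure is translation invariant again, hence a multiple of
    Lebesgue measure; the value at [B] shows that the factor is one. *)
Lemma mu_affine_involution (phi : point -> point) (L : point -> point) (B : set point) :
  measurable_fun [set: point] phi -> involutive phi ->
  (forall x t, phi (x + t) = phi x + L t) ->
  measurable B -> phi @^-1` B = B -> (0 < mu B)%E -> (mu B < +oo)%E ->
  forall A, measurable A -> mu (phi @^-1` A) = mu A.
Proof.
move=> mphi phiK phiL mB phiB B0 Boo A mA.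
(* the linear part of an affine involution is an involution *)
have LK t : L (L t) = t.
  by rewrite -[RHS](phiK t) -[t in RHS]add0r !phiL phiK add0r.
have [m2 m2E] := sigma_finite_measure_of mu_sigma_finite.
have [|m1 m1E] := @sigma_finite_measure_of
  (measure_function_pushforward__canonical__measure_function_Measure mu mphi).
  have [F FT Ffin] := mu_sigma_finite.
  exists (fun k => phi @^-1` F k).
    by rewrite -preimage_bigcup -FT preimage_setT.
  move=> k; have [mF Fk] := Ffin k; split; first exact: measurable_preimage.
  rewrite /= /pushforward (_ : _ @^-1` _ = F k)//.
  by apply/seteqP; split => x /=; rewrite phiK.
have t2 : translation_invariant m2 by rewrite m2E; exact: mu_translation.
have t1 : translation_invariant m1.
  move=> t C mC; rewrite m1E /= /pushforward.
  rewrite -(mu_translation (L t) (measurable_preimage mphi mC)).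
  by congr (mu _); apply/seteqP; split => x /=; rewrite phiL LK.
have := translation_invariant_unique t2 t2 mA mB.
have := translation_invariant_unique t1 t2 mA mB.
rewrite m1E m2E /= /pushforward phiB => <-.
move: (mu B) B0 Boo => [b| |]//; rewrite lte_fin => b0 _.
move: (mu _) (mu _) => [x| |] [y| |]//.
- by rewrite -!EFinM => -[/mulIf-> //]; rewrite gt_eqF.
- by rewrite gt0_mulye ?lte_fin.
- by rewrite gt0_mulNye ?lte_fin.
- by rewrite gt0_mulye ?lte_fin.
- by rewrite gt0_mulye ?gt0_mulNye ?lte_fin.
- by rewrite gt0_mulNye ?lte_fin.
- by rewrite gt0_mulye ?gt0_mulNye ?lte_fin.
Qed.

End lebesgue.

(** * Measure of simplices and means of barycentric coordinates *)

Section simplex_measure.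
Context {R : realType} {d : nat}.
Notation point := 'rV[R]_d.
Notation mu := (@lebesgue_rV R d).
Implicit Types (K S F : {fset point}) (x y v p : point) (f : point -> R).

Lemma affine_measurable f : affine f -> measurable_fun [set: point] f.
Proof.
move=> [b [a fE]]; have -> : f = (fun x => b + \sum_i a ord0 i * x ord0 i).
  by apply/funext => x; rewrite fE.
apply: measurable_funD => //; apply: measurable_sum => i.
by apply: measurable_funM => //; exact: measurable_coord.
Qed.

Lemma measurable_conv K : simplex K -> measurable (conv K).
Proof.
move=> sK; rewrite convE//.
have -> : [set x | forall v, v \in K -> 0 <= bc K v x] =
    \big[setI/setT]_(v <- K) (bc K v @^-1` `[0, +oo[).
  by rewrite -bigcap_seq; apply/seteqP; split => x h v /h;
    rewrite /= in_itv /= andbT.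
apply: bigsetI_measurable => v _; rewrite -[X in measurable X]setTI.
by apply: (affine_measurable (@bc_affine _ _ K v)) => //; exact: measurable_itv.
Qed.

Lemma affine_conv_bound K f x : affine f -> conv K x ->
  `|f x| <= \sum_(v <- K) `|f v|.
Proof.
move=> af [l [l0 l1 ->]]; rewrite affine_sum// (le_trans (ler_norm_sum _ _ _))//.
rewrite [X in X <= _]big_seq [X in _ <= X]big_seq; apply: ler_sum => v vK.
rewrite normrM ler_piMl// ger0_norm ?l0// -l1 (bigD1_seq v) ?fset_uniq//= lerDl.
by rewrite big_seq_cond sumr_ge0// => u /andP[uK _]; exact: l0.
Qed.

Lemma conv_cube K : exists2 e, 0 < e & conv K `<=` cube 0 e.
Proof.
pose e := 1 + \sum_(i < d) \sum_(v <- K) `|v ord0 i|.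
have s0 i : 0 <= \sum_(v <- K) `|v ord0 i| by rewrite sumr_ge0.
exists e; first by rewrite ltr_pwDl// sumr_ge0.
move=> x Kx; apply/cubeE => i; rewrite mxE subr0.
have ai : affine (fun y : point => y ord0 i).
  exists 0, (delta_mx ord0 i) => y; rewrite add0r /dot (bigD1 i)//= mxE !eqxx.
  by rewrite mul1r big1 ?addr0// => j /negbTE ji; rewrite mxE ji andbF mul0r.
apply: (le_trans (affine_conv_bound ai Kx)).
rewrite /e (bigD1 i)//= addrCA lerDl addr_ge0// sumr_ge0//.
Qed.

Lemma mu_conv_lty K : simplex K -> (mu (conv K) < +oo)%E.
Proof.
move=> sK; have [e e0 Ke] := conv_cube K.
apply: (@le_lt_trans _ _ (mu (cube 0 e))); last by rewrite mu_cube// ltry.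
by apply: le_measure => //; rewrite inE; [exact: measurable_conv|exact: measurable_cube].
Qed.

Lemma mu_conv_gt0 K : simplex K -> (0 < mu (conv K))%E.
Proof.
move=> sK; have /nbhs_ballP[e /= e0 be] : nbhs (barycenter K) (conv K).
  apply: filterS (open_simplex_conv sK) _; apply: open_nbhs_nbhs; split.
    exact: open_simplex_open.
  exact: barycenter_open_simplex.
apply: (@lt_le_trans _ _ (mu (cube (barycenter K) (e / 2)))).
  by rewrite mu_cube ?divr_gt0// lte_fin exprn_gt0// addr_gt0// divr_gt0.
apply: le_measure; rewrite ?inE; [exact: measurable_cube|exact: measurable_conv|].
apply: subset_trans be => x /cubeE h; split => // i j.
rewrite ord1 /ball /= distrC.
by apply: le_lt_trans (h j) _; rewrite ltr_pdivrMr//; lra.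
Qed.

Lemma fine_mu_conv_gt0 K : simplex K -> 0 < fine (mu (conv K)).
Proof. by move=> sK; rewrite fine_gt0// mu_conv_gt0// mu_conv_lty. Qed.

(** The translates of [A] by the multiples [1 / (n + 1)] of [u] are disjoint
    since [f] separates them; infinitely many sets of equal positive measure do not
    fit into a cube. *)
Lemma slice_negligible (A : set point) f u e c : measurable A -> 0 < e ->
  A `<=` cube 0 e -> (forall x, A x -> f x = c) ->
  (forall x t, f (x + t *: u) = f x + t) -> mu A = 0%E.
Proof.
move=> mA e0 Ae fA fu.
pose s (n : nat) : R := n.+1%:R^-1.
pose T n := (fun x => x + - s n *: u) @^-1` A.
have mT n : measurable (T n) by exact: (measurable_preimage (measurable_shift _)).
have fT n x : T n x -> f x = c + s n.
  move=> /fA; rewrite fu => <-; ring.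
have tT : trivIset setT T.
  apply/trivIsetP => i j _ _ ij; apply/seteqP; split => // x [/fT fi /fT fj].
  move: fi; rewrite fj => /addrI/invr_inj/eqP; rewrite eqr_nat eqSS => /eqP ji.
  by rewrite ji eqxx in ij.
pose r := \sum_i `|u ord0 i|.
have r0 : 0 <= r by rewrite sumr_ge0.
have Tr n : T n `<=` cube 0 (e + r).
  move=> x /Ae/cubeE h; apply/cubeE => i; have := h i; rewrite !mxE !subr0.
  move=> hi; have -> : x ord0 i = (x ord0 i + - s n * u ord0 i) + s n * u ord0 i.
    by ring.
  rewrite (le_trans (ler_normD _ _))// lerD// normrM ger0_norm ?invr_ge0//.
  rewrite (@le_trans _ _ `|u ord0 i|)//.
    by rewrite ler_piMl// invf_le1// ler1n.
  by rewrite /r (bigD1 i)//= lerDl sumr_ge0.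
have Afin : mu A \is a fin_num.
  rewrite ge0_fin_numE//; apply: (@le_lt_trans _ _ (mu (cube 0 e))).
    by apply: le_measure; rewrite ?inE//; exact: measurable_cube.
  by rewrite mu_cube// ltry.
have hN N : fine (mu A) *+ N <= (e + r + (e + r)) ^+ d.
  rewrite -lee_fin -(mu_cube 0) ?ltr_pwDl//.
  apply: (@le_trans _ _ (mu (\big[setU/set0]_(i < N) T i))).
    rewrite measure_bigsetU// (eq_bigr (fun=> (fine (mu A))%:E)).
      by rewrite sumEFin sumr_const card_ord.
    by move=> i _; rewrite fineK//; exact: mu_translation.
  apply: le_measure; rewrite ?inE; [|exact: measurable_cube|].
    by apply: bigsetU_measurable => i _; exact: mT.
  by rewrite -bigcup_seq => x [i _]; exact: Tr.
rewrite -(fineK Afin); congr EFin; apply/eqP.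
have a0 : 0 <= fine (mu A) by exact: fine_ge0.
rewrite eq_le a0 andbT leNgt; apply/negP => a_gt0.
have := hN (Num.truncn ((e + r + (e + r)) ^+ d / fine (mu A))).+1.
rewrite leNgt -mulr_natr mulrC -ltr_pdivrMr// => /negP; apply.
exact: truncnS_gt.
Qed.

Lemma face_negligible K v : (0 < d)%N -> simplex K -> v \in K ->
  mu (conv K `&` [set x | bc K v x = 0]) = 0%E.
Proof.
move=> d0 sK vK; have [e e0 Ke] := conv_cube K.
have [w wK wv] : exists2 w, w \in K & w != v.
  have : (0 < #|` (K `\ v)%fset|)%N
    by have := cardfsD1 v K; rewrite vK (proj1 sK) add1n => -[<-].
  by rewrite cardfs_gt0 => /fset0Pn[w]; rewrite !inE => /andP[wv wK]; exists w.
apply: (@slice_negligible _ (bc K v) (v - w) e 0) => //.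
- apply: measurableI; first exact: measurable_conv.
  have mb := affine_measurable (@bc_affine _ _ K v).
  by have := mb measurableT _ (measurable_set1 0); rewrite setTI.
- by move=> x [/Ke].
- by move=> x [].
- move=> x t; rewrite affine_diff; last exact: bc_affine.
  rewrite (bc_vertex sK vK vK) (bc_vertex sK vK wK).
  by rewrite eqxx eq_sym (negbTE wv) subr0 mulr1.
Qed.

(** This affine map exchanges the vertices [p] and [v] and fixes the other
    vertices. *)
Definition vertex_swap K p v x : point := x + (bc K v x - bc K p x) *: (p - v).

Section vertex_swap.
Variables (K : {fset point}) (p v : point).
Hypotheses (sK : simplex K) (pK : p \in K) (vK : v \in K) (pv : p != v).
Let swap := vertex_swap K p v.

Lemma bc_swap u x : u \in K -> bc K u (swap x) =
  bc K u x + (bc K v x - bc K p x) * ((u == p)%:R - (u == v)%:R).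
Proof.
move=> uK; rewrite /swap /vertex_swap affine_diff; last exact: bc_affine.
by rewrite (bc_vertex sK uK pK) (bc_vertex sK uK vK).
Qed.

Lemma bc_swap_p x : bc K p (swap x) = bc K v x.
Proof. by rewrite bc_swap// eqxx (negbTE pv) /=; ring. Qed.

Lemma bc_swap_v x : bc K v (swap x) = bc K p x.
Proof. by rewrite bc_swap// eqxx eq_sym (negbTE pv) /=; ring. Qed.

Lemma swapK : involutive swap.
Proof.
move=> x; rewrite {1}/swap /vertex_swap -/(swap x) bc_swap_p bc_swap_v /swap.
by rewrite /vertex_swap -addrA -scalerDl addrA subrK subrr scale0r addr0.
Qed.

Lemma swap_conv : swap @^-1` conv K = conv K.
Proof.
have sub x : conv K x -> conv K (swap x).
  rewrite convE//= => h u uK; have [->|up] := eqVneq u p.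
    by rewrite bc_swap_p h.
  have [->|uv] := eqVneq u v; first by rewrite bc_swap_v h.
  by rewrite bc_swap// (negbTE up) (negbTE uv) subr0 mulr0 addr0 h.
by apply/seteqP; split => x => [/sub|/sub//]; rewrite swapK.
Qed.

Lemma measurable_swap : measurable_fun [set: point] swap.
Proof.
apply: measurable_fun_rV => i.
have -> : (fun x => swap x ord0 i) =
    (fun x => x ord0 i + (bc K v x - bc K p x) * (p - v) ord0 i).
  by apply/funext => x; rewrite !mxE.
apply: measurable_funD; first exact: measurable_coord.
apply: measurable_funM => //.
by apply: measurable_funB; apply: affine_measurable; exact: bc_affine.
Qed.

Lemma mu_swap A : measurable A -> mu (swap @^-1` A) = mu A.
Proof.
have [b [a vE]] := @bc_affine _ _ K v; have [b' [a' pE]] := @bc_affine _ _ K p.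
apply: (@mu_affine_involution _ _ swap
  (fun t => t + (dot a t - dot a' t) *: (p - v)) (conv K)).
- exact: measurable_swap.
- exact: swapK.
- move=> x t; rewrite /swap /vertex_swap !vE !pE !dotDr.
  by apply/rowP => i; rewrite !mxE; ring.
- exact: measurable_conv.
- exact: swap_conv.
- exact: mu_conv_gt0.
- exact: mu_conv_lty.
Qed.

Lemma integral_bc_swap :
  \int[mu]_(x in conv K) bc K v x = \int[mu]_(x in conv K) bc K p x.
Proof.
suff E : (\int[mu]_(x in conv K) (bc K v x)%:E =
    \int[mu]_(x in conv K) (bc K p x)%:E)%E by rewrite /Rintegral E.
transitivity (\int[pushforward mu swap]_(x in conv K) (bc K p x)%:E)%E.
  apply/esym; apply: (etrans (ge0_integral_pushforward measurable_swap _ _ _ _)).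
  - exact: measurable_conv.
  - apply/measurable_EFinP; apply: (measurable_funS (E := setT)) => //.
    by apply: affine_measurable; exact: bc_affine.
  - by move=> x; rewrite inE convE// => h; rewrite lee_fin h.
  - by rewrite swap_conv; apply: eq_integral => x _ /=; rewrite bc_swap_p.
apply: (@eq_measure_integral _ _ _ _ _
  (measure_function_pushforward__canonical__measure_function_Measure mu measurable_swap)).
by move=> A mA _; exact: mu_swap.
Qed.

End vertex_swap.

Lemma affine_bounded K f : affine f -> [bounded f x | x in conv K].
Proof.
move=> af; exists (\sum_(v <- K) `|f v|); split; first exact: num_real.
move=> M /ltW MM x Kx /=; apply: le_trans MM; exact: affine_conv_bound.
Qed.

Lemma affine_integrable K f : simplex K -> affine f ->
  mu.-integrable (conv K) (EFin \o f).
Proof.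
move=> sK af; apply: measurable_bounded_integrable.
- exact: measurable_conv.
- exact: mu_conv_lty.
- by apply: (measurable_funS (E := setT)) => //; exact: affine_measurable.
- exact: affine_bounded.
Qed.

Lemma affine_bigD (I : Type) (s : seq I) (f : I -> point -> R) :
  (forall i, affine (f i)) -> affine (fun x => \sum_(i <- s) f i x).
Proof.
move=> af; elim: s => [|i s ih].
  rewrite (_ : (fun _ => _) = fun=> 0); first exact: affine_cst.
  by apply/funext => x; rewrite big_nil.
rewrite (_ : (fun _ => _) = fun x => f i x + \sum_(i <- s) f i x).
  exact: affineD.
by apply/funext => x; rewrite big_cons.
Qed.

Lemma Rintegral_affine_sum K (I : Type) (s : seq I) (f : I -> point -> R) :
  simplex K -> (forall i, affine (f i)) ->
  \int[mu]_(x in conv K) (\sum_(i <- s) f i x) =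
  \sum_(i <- s) \int[mu]_(x in conv K) f i x.
Proof.
move=> sK af; elim: s => [|i s ih].
  rewrite big_nil; under eq_Rintegral do rewrite big_nil.
  by rewrite Rintegral_cst ?mul0r//; exact: measurable_conv.
rewrite big_cons -ih -RintegralD//.
- by apply: eq_Rintegral => x _; rewrite big_cons.
- exact: measurable_conv.
- exact: affine_integrable.
- by apply: affine_integrable => //; exact: affine_bigD.
Qed.

(** The coordinates have equal integrals by symmetry, and their sum is one. *)
Lemma mean_bc K v : simplex K -> v \in K ->
  (fine (mu (conv K)))^-1 * (\int[mu]_(x in conv K) bc K v x) = d.+1%:R^-1.
Proof.
move=> sK vK; have m0 := fine_mu_conv_gt0 sK.
have : \int[mu]_(x in conv K) (\sum_(u <- K) bc K u x) = fine (mu (conv K)).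
  under eq_Rintegral do rewrite bc_sum1//.
  by rewrite Rintegral_cst ?mul1r//; exact: measurable_conv.
rewrite Rintegral_affine_sum//; last by move=> u; exact: bc_affine.
rewrite (eq_big_seq (fun=> \int[mu]_(x in conv K) bc K v x)); last first.
  move=> u uK; have [->//|uv] := eqVneq u v.
  by apply: integral_bc_swap => //; rewrite eq_sym.
rewrite big_const_seq count_predT iter_addr addr0.
have -> : size K = d.+1 by case: sK.
move: m0; move: (fine _) (Rintegral _ _ _) => m i m0 mE.
rewrite -mE -[i *+ _]mulr_natl in m0 *; rewrite invfM -mulrA mulVf ?mulr1//.
by apply: contraTneq m0 => ->; rewrite mulr0 ltxx.
Qed.

End simplex_measure.

(** * Polynomials of low degree *)

Section polynomials.
Context {R : realType} {d : nat}.
Notation point := 'rV[R]_d.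
Implicit Types (f g : point -> R).

Lemma Pk_lin k (a : R) f g : Pk k f -> Pk k g -> Pk k (a *: f + g).
Proof.
move=> [p pk pE] [q qk qE]; exists (a *: p + q) => [m|x].
  rewrite mpoly.mcoeffD mpoly.mcoeffZ; have [p0|pm _] := eqVneq (mpoly.mcoeff m p) 0.
    by rewrite p0 mulr0 add0r; exact: qk.
  exact: pk.
by rewrite mpoly.mevalD mpoly.mevalZ -pE -qE.
Qed.

Lemma Pk_cst k (c : R) : Pk k ((fun=> c) : point -> R).
Proof.
exists (mpoly.mpolyC d c) => [m|x]; last by rewrite mpoly.mevalC.
rewrite mpoly.mcoeffC; case: (boolP (m == _)) => [/eqP->|_]; first by rewrite mpoly.mdeg0.
by rewrite mulr0 eqxx.
Qed.

Lemma Pk1_affine f : affine f -> Pk 1 f.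
Proof.
move=> [b [a fE]].
have Pk_add g h : Pk 1 g -> Pk 1 h -> Pk 1 (g + h).
  by move=> Pg; rewrite -[g]scale1r; exact: Pk_lin.
have -> : f = (fun=> b) + \sum_i (a ord0 i *: (fun x : point => x ord0 i) + 0).
  apply/funext => x; rewrite fE; congr (_ + _).
  by rewrite fct_sumE; apply: eq_bigr => i _; rewrite addr0.
apply: (Pk_add); first exact: Pk_cst.
elim/big_ind: _ => [||i _]; [exact: Pk_cst|exact: Pk_add|].
apply: Pk_lin; last exact: Pk_cst.
exists (mpoly.mpolyX R (mpoly.mnm1 i)) => [m|x]; last by rewrite mpoly.mevalXU.
rewrite mpoly.mcoeffX; case: (boolP (_ == m)) => [/eqP<-|_].
  by rewrite mpoly.mdeg1.
by rewrite eqxx.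
Qed.

Lemma Pk0_cst f : Pk 0 f -> exists c, forall x, f x = c.
Proof.
move=> [p p0 fE]; exists (mpoly.meval (fun=> 0) p) => x.
rewrite fE !mpoly.mevalE; apply: eq_big_seq => m.
rewrite mpoly.mcoeff_msupp => /p0; rewrite leqn0 mpoly.mdeg_eq0 => /eqP ->.
by congr (_ * _); apply: eq_bigr => i _; rewrite mpoly.mnm0E !expr0.
Qed.

End polynomials.

(** * Piecewise polynomials and elementwise means *)

Section piecewise_spaces.
Context {R : realType} {d : nat} (Omega GammaD : set 'rV[R]_d).
Context (Th : {fset {fset 'rV[R]_d}}).
Hypothesis d_gt0 : (0 < d)%N.
Hypothesis hTh : regular_triangulation Th Omega.
Hypothesis bO : boundary Omega `<=`
  \bigcup_(S in sides Th) conv S.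
Notation point := 'rV[R]_d.
Notation mu := (@lebesgue_rV R d).
Implicit Types (K S : {fset point}) (x p : point) (v w f : point -> R).
Implicit Types (q r : {fset point} -> point -> R).

Lemma ae_fset (T : choiceType) (s : {fset T}) (P : T -> point -> Prop) :
  (forall i, i \in s -> \forall x \ae mu, P i x) ->
  \forall x \ae mu, forall i, i \in s -> P i x.
Proof.
move=> h; have : \forall x \ae mu, (\bigcap_(i in [set` s]) P i) x.
  exact: filter_bigI h.
by apply: filterS => x hx i /hx.
Qed.

(** Almost every point is generic. A generic point lies in one element at most
    and, when it lies in an element, not on the boundary of the domain; this turns
    statements about almost every point of an element or of the domain into
    pointwise ones. *)
Definition generic x :=
  forall K, K \in Th -> forall p, p \in K -> conv K x -> bc K p x <> 0.

Lemma ae_generic : \forall x \ae mu, generic x.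
Proof.
apply: ae_fset => K KT; apply: ae_fset => p pK.
have sK := tri_simplex hTh KT.
exists (conv K `&` [set x | bc K p x = 0]); split.
- apply: measurableI; first exact: measurable_conv.
  have mb := affine_measurable (@bc_affine _ _ K p).
  by have := mb measurableT _ (measurable_set1 0); rewrite setTI.
- exact: face_negligible.
- by move=> x /= /not_implyP[Kx /contrapT].
Qed.

Lemma generic_unique x K K' : generic x -> K \in Th -> K' \in Th ->
  conv K x -> conv K' x -> K = K'.
Proof.
move=> gx KT KT' Kx Kx'; apply/eqP/negPn/negP => KK'.
have [p pK pK'] := tri_vertex_notin hTh KT KT' KK'.
by apply: (gx K KT p pK Kx); exact: (tri_meet hTh KT KT' pK pK' Kx Kx').
Qed.

(** The boundary of the domain consists of sides of elements. *)
Lemma generic_interior x K : generic x -> K \in Th -> conv K x -> Omega x.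
Proof.
move=> gx KT Kx; apply: contrapT => nOx.
have [S [K' KT' sS] Sx] : (\bigcup_(S in sides Th) conv S) x.
  apply: bO; split; first exact: (tri_closure hTh KT).
  by move=> /interior_subset.
have sK' := tri_simplex hTh KT'.
have [p [pK' pS KE]] := side_of_opp (proj1 sK') sS.
have [SK' _] := sS.
apply: (gx K' KT' p pK'); first exact: conv_subset Sx.
exact: bc_face Sx.
Qed.

Lemma Linfty_lin (a : R) v w : Linfty Omega v -> Linfty Omega w ->
  Linfty Omega (a *: v + w).
Proof.
move=> [mv [M hM]] [mw [N hN]]; split.
  apply: measurable_funD => //; exact: measurable_funM.
exists (`|a| * M + N); apply: filterS2 hM hN => x h1 h2 Ox.
rewrite (le_trans (ler_normD _ _))// lerD//; last exact: h2.
by rewrite normrM ler_wpM2l// h1.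
Qed.

Lemma Linfty_integrable v K : K \in Th -> Linfty Omega v ->
  mu.-integrable (conv K) (EFin \o v).
Proof.
move=> KT [mv [M hM]]; have sK := tri_simplex hTh KT.
have mvK : measurable_fun (conv K) (EFin \o v).
  by apply/measurable_EFinP; exact: measurable_funS mv.
apply/integrableP; split => //.
have mc := measurable_conv sK.
apply: (@le_lt_trans _ _ (\int[mu]_(x in conv K) (`|M|)%:E)%E).
  apply: ae_ge0_le_integral => //.
  - exact: measurableT_comp.
  - apply: filterS2 hM ae_generic => x hx gx Kx.
    rewrite /= lee_fin (le_trans _ (ler_norm M))// hx//.
    exact: generic_interior gx KT Kx.
by rewrite integral_cst// lte_mul_pinfty// mu_conv_lty.
Qed.

Lemma piecewise_lin k (a : R) v w q r : piecewise k Th v q ->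
  piecewise k Th w r -> piecewise k Th (a *: v + w) (fun K => a *: q K + r K).
Proof.
move=> hv hw K KT; have [Pq vq] := hv K KT; have [Pr wr] := hw K KT.
split; first exact: Pk_lin.
by apply: filterS2 vq wr => x h1 h2 Kx; rewrite /= /GRing.add /= /GRing.scale /= h1// h2.
Qed.

Lemma CR_D_lin (a : R) v w : CR_D Th Omega GammaD v -> CR_D Th Omega GammaD w ->
  CR_D Th Omega GammaD (a *: v + w).
Proof.
move=> [[Lv [q1 pq1 hq1]] [q2 pq2 hq2]] [[Lw [r1 pr1 hr1]] [r2 pr2 hr2]].
split; first split; first exact: Linfty_lin.
  exists (fun K => a *: q1 K + r1 K); first exact: piecewise_lin.
  move=> S K1 K2 T1 T2 S1 S2.
  by congr (a * _ + _); [exact: hq1 S1 S2|exact: hr1 S1 S2].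
exists (fun K => a *: q2 K + r2 K); first exact: piecewise_lin.
move=> S K KT sS SG.
have -> : (a *: q2 K + r2 K) (barycenter S) =
   a * q2 K (barycenter S) + r2 K (barycenter S) by [].
by rewrite (hq2 S K)// (hr2 S K)// mulr0 addr0.
Qed.

Lemma Pi_h_lin (a : R) v w : Linfty Omega v -> Linfty Omega w ->
  Pi_h Th (a *: v + w) = a *: Pi_h Th v + Pi_h Th w.
Proof.
move=> Lv Lw; apply/funext => x.
have -> : (a *: Pi_h Th v + Pi_h Th w) x = a * Pi_h Th v x + Pi_h Th w x by [].
rewrite /Pi_h mulr_sumr -big_split; apply: eq_big_seq => K KT /=.
have mc := measurable_conv (tri_simplex hTh KT).
have iv := Linfty_integrable KT Lv; have iw := Linfty_integrable KT Lw.
have -> : \int[mu]_(y in conv K) (a *: v + w) y =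
    a * (\int[mu]_(y in conv K) v y) + \int[mu]_(y in conv K) w y.
  rewrite -(RintegralZl a mc iv).
  exact: (RintegralD mc (integrableZl mc a iv) iw).
by ring.
Qed.

Lemma Pi_h_image_lin (a : R) v w :
  Pi_h_image Th Omega (CR_D Th Omega GammaD) v ->
  Pi_h_image Th Omega (CR_D Th Omega GammaD) w ->
  Pi_h_image Th Omega (CR_D Th Omega GammaD) (a *: v + w).
Proof.
move=> [Lv [v' Cv' vE]] [Lw [w' Cw' wE]]; split; first exact: Linfty_lin.
exists (a *: v' + w'); first exact: CR_D_lin.
have [[Lv' _] _] := Cv'; have [[Lw' _] _] := Cw'; rewrite Pi_h_lin//.
by apply: filterS2 vE wE => x h1 h2 Ox; congr (a * _ + _); [exact: h1|exact: h2].
Qed.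

Lemma Linfty_cst (c : R) : Linfty Omega (fun=> c).
Proof. by split => //; exists `|c|; exact: aeW. Qed.

Lemma piecewise_cst k (c : R) : piecewise k Th (fun=> c) (fun _ _ => c).
Proof. by move=> K KT; split; [exact: Pk_cst|exact: aeW]. Qed.

Lemma CR_D_0 : CR_D Th Omega GammaD 0.
Proof.
split; first split; first exact: (Linfty_cst 0).
  by exists (fun _ _ => 0) => //; exact: piecewise_cst.
by exists (fun _ _ => 0) => //; exact: piecewise_cst.
Qed.

Lemma Pi_h_image_null v : Linfty Omega v -> v = (fun=> 0) %[ae mu in Omega] ->
  Pi_h_image Th Omega (CR_D Th Omega GammaD) v.
Proof.
move=> Lv v0; split => //; exists 0; first exact: CR_D_0.
suff -> : Pi_h Th 0 = fun=> 0 by [].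
apply/funext => x; rewrite /Pi_h big1_seq// => K /= KT.
by rewrite Rintegral_cst ?mul0r ?mulr0 ?mul0r//;
  exact: measurable_conv (tri_simplex hTh KT).
Qed.

Lemma broken_Pk_lin k (a : R) v w : broken_Pk k Th Omega v ->
  broken_Pk k Th Omega w -> broken_Pk k Th Omega (a *: v + w).
Proof.
move=> [Lv [q hq]] [Lw [r hr]]; split; first exact: Linfty_lin.
by exists (fun K => a *: q K + r K); exact: piecewise_lin.
Qed.

(** Since elements overlap in null sets only, this represents the function with
    the pieces [q K]. A projection [Pi_h] has this form with constant pieces. *)
Definition assemble q : point -> R := fun x => \sum_(K <- Th) q K x * \1_(conv K) x.

Lemma assemble_generic q x K : generic x -> K \in Th -> conv K x ->
  assemble q x = q K x.
Proof.
move=> gx KT Kx; rewrite /assemble (bigD1_seq K) ?fset_uniq//= indicE mem_set//.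
rewrite mulr1 big_seq_cond big1 ?addr0// => K' /andP[KT' KK'].
rewrite indicE memNset ?mulr0// => Kx'.
by rewrite (generic_unique gx KT KT' Kx Kx') eqxx in KK'.
Qed.

Lemma assemble_Linfty q : (forall K, K \in Th -> affine (q K)) ->
  Linfty Omega (assemble q).
Proof.
move=> aq; split.
  have -> : assemble q = (fun x => \sum_(K <- Th)
      (if K \in Th then q K x * \1_(conv K) x else 0)).
    by apply/funext => x; apply: eq_big_seq => K ->.
  apply: measurable_sum => K; have [KT|_] := boolP (K \in Th); last exact: measurable_cst.
  apply: measurable_funM; first exact: affine_measurable (aq K KT).
  exact: measurable_indic (measurable_conv (tri_simplex hTh KT)).
exists (\sum_(K <- Th) \sum_(v <- K) `|q K v|); apply: aeW => x _.
rewrite (le_trans (ler_norm_sum _ _ _))// [X in X <= _]big_seq [X in _ <= X]big_seq.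
apply: ler_sum => K KT; rewrite indicE.
have [/set_mem Kx|Kx] := boolP (x \in conv K).
  by rewrite mulr1; exact: affine_conv_bound (aq K KT) Kx.
by rewrite mulr0 normr0 sumr_ge0.
Qed.

Lemma assemble_piecewise q k : (forall K, K \in Th -> Pk k (q K)) ->
  piecewise k Th (assemble q) q.
Proof.
move=> pq K KT; split; first exact: pq.
by apply: filterS ae_generic => x gx Kx; exact: assemble_generic.
Qed.

Lemma Pi_h_piecewise v q : Linfty Omega v -> piecewise 1 Th v q ->
  (forall K, K \in Th -> affine (q K)) ->
  Pi_h Th v = assemble (fun K _ =>
    (fine (mu (conv K)))^-1 * \int[mu]_(y in conv K) q K y).
Proof.
move=> [mv _] pv aq; apply/funext => x; apply: eq_big_seq => K KT.
congr (_ * _ * _); rewrite /Rintegral; congr fine.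
have mc := measurable_conv (tri_simplex hTh KT).
apply: ae_eq_integral => //.
- by apply/measurable_EFinP; exact: measurable_funS mv.
- apply/measurable_EFinP; apply: measurable_funS (affine_measurable (aq K KT)) => //.
- have [_ vq] := pv K KT; by apply: filterS vq => y h Ky; rewrite h.
Qed.

End piecewise_spaces.

(** * The Crouzeix-Raviart basis and the image of the projection *)

Section crouzeix_raviart.
Context {R : realType} {d : nat} (Omega GammaD : set 'rV[R]_d).
Context (Th : {fset {fset 'rV[R]_d}}).
Hypothesis d_gt0 : (0 < d)%N.
Hypothesis hTh : regular_triangulation Th Omega.
Hypothesis oO : open Omega.
Hypothesis bO : boundary Omega `<=` \bigcup_(S in sides Th) conv S.
Notation point := 'rV[R]_d.
Notation mu := (@lebesgue_rV R d).
Implicit Types (K S : {fset point}) (x p : point) (v w : point -> R).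
Local Notation U := (Pi_h_image Th Omega (CR_D Th Omega GammaD)).
Local Notation e K := (\1_(conv K) : point -> R).

(** When [S] is the facet of [K] opposite to [p], the sum reduces to the
    coordinate at [p]. Summing over the difference avoids the choice of [p]. *)
Definition side_fun S K : point -> R := fun x =>
  if (S `<=` K)%fset then 1 - d%:R * \sum_(p <- (K `\` S)%fset) bc K p x else 0.

Lemma side_fun_affine S K : affine (side_fun S K).
Proof.
rewrite /side_fun; have [_|_] := boolP (S `<=` K)%fset; last exact: affine_cst.
have sa := @affine_bigD R d _ (enum_fset (K `\` S)%fset) (bc K)
  (fun p => @bc_affine _ _ K p).
have := affineD (affine_cst 1) (affineZ (- d%:R) sa).
by rewrite (_ : (fun x => 1 + _) = fun x => 1 - d%:R *
  \sum_(p <- (K `\` S)%fset) bc K p x)//; apply/funext => x; rewrite mulNr.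
Qed.

Lemma side_fun_opp S K p : K \in Th -> side_of S K -> p \in K -> p \notin S ->
  forall x, side_fun S K x = 1 - d%:R * bc K p x.
Proof.
move=> KT sS pK pS x; have [cK _] := tri_simplex hTh KT.
have [p' [p'K p'S KE]] := side_of_opp cK sS.
have pp : p = p' by move: pK; rewrite KE !inE (negbTE pS) orbF => /eqP.
rewrite /side_fun (proj1 sS); congr (_ - _ * _).
have -> : (K `\` S)%fset = [fset p]%fset.
  apply/fsetP => u; rewrite {1}KE !inE -pp.
  by case: (eqVneq u p) => [->|_] /=; [rewrite pS|rewrite andNb].
by rewrite big_seq_fset1.
Qed.

(** The coordinate opposite to [S] vanishes at the barycenter of [S] and is
    [1 / d] at those of the other sides. The value does not depend on the element,
    which is the continuity required of the basis function. *)
Lemma side_fun_barycenter S S' K : K \in Th -> #|` S| = d -> side_of S' K ->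
  side_fun S K (barycenter S') = (S' == S)%:R.
Proof.
move=> KT cS sS'; have sK := tri_simplex hTh KT.
have [SK|SK] := boolP (S `<=` K)%fset; last first.
  rewrite /side_fun (negbTE SK); case: eqVneq => // S'S.
  by move: SK; rewrite -S'S (proj1 sS').
have sS : side_of S K by [].
have [p [pK pS KE]] := side_of_opp (proj1 sK) sS.
have [S'K cS'] := sS'.
rewrite (side_fun_opp KT sS pK pS) bc_barycenter ?cS'//.
have [->|S'S] := eqVneq S' S; first by rewrite (negbTE pS) mul0r mulr0 subr0.
rewrite (side_of_neq (proj1 sK) sS sS' pK pS S'S) mul1r divff ?subrr//.
by rewrite pnatr_eq0 -lt0n.
Qed.

(** The Crouzeix-Raviart basis function of the side [S], normalized to be one at
    the barycenter of [S]. *)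
Definition side_basis S := assemble Th (side_fun S).

Lemma side_basis_CR_D S : sides Th S -> ~ conv S `<=` GammaD ->
  CR_D Th Omega GammaD (side_basis S).
Proof.
move=> [K0 KT0 [SK0 cS]] nSD.
have pw : piecewise 1 Th (side_basis S) (side_fun S).
  apply: (assemble_piecewise d_gt0 hTh) => K KT.
  by apply: Pk1_affine; exact: side_fun_affine.
split; first split.
- by apply: (assemble_Linfty hTh) => K KT; exact: side_fun_affine.
- exists (side_fun S) => // S' K1 K2 KT1 KT2 sS1 sS2.
  by rewrite !side_fun_barycenter.
- exists (side_fun S) => // S' K KT sS' S'D.
  by rewrite side_fun_barycenter//; case: eqVneq => // S'S; rewrite S'S in S'D.
Qed.

Lemma mean_side_fun S K : K \in Th -> #|` S| = d ->
  (fine (mu (conv K)))^-1 * (\int[mu]_(x in conv K) side_fun S K x) =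
  if (S `<=` K)%fset then d.+1%:R^-1 else 0.
Proof.
move=> KT cS; have sK := tri_simplex hTh KT; have mc := measurable_conv sK.
have m0 : fine (mu (conv K)) != 0 by rewrite gt_eqF// fine_mu_conv_gt0.
have [SK|SK] := boolP (S `<=` K)%fset; last first.
  rewrite (_ : side_fun S K = fun=> 0).
    by rewrite Rintegral_cst// mul0r mulr0.
  by apply/funext => x; rewrite /side_fun (negbTE SK).
have sS : side_of S K by [].
have [p [pK pS KE]] := side_of_opp (proj1 sK) sS.
have bi := affine_integrable sK (@bc_affine _ _ K p).
have -> : side_fun S K = fun x => 1 + - d%:R * bc K p x.
  by apply/funext => x; rewrite (side_fun_opp KT sS pK pS) mulNr.
rewrite RintegralD//; last 2 first.
- exact: affine_integrable (affine_cst 1).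
- by apply: affine_integrable => //; apply: affineZ; exact: bc_affine.
rewrite Rintegral_cst// mul1r mulrDr mulVf// RintegralZl//.
rewrite mulrCA mean_bc// -[d.+1%:R]natr1; field.
by rewrite natr1 pnatr_eq0.
Qed.

(** The basis function has the mean [1 - d / (d + 1) = 1 / (d + 1)] on all the
    elements having the side [S]. *)
Lemma side_indic_image S : sides Th S -> ~ conv S `<=` GammaD ->
  U (assemble Th (fun K _ => (S `<=` K)%fset%:R)).
Proof.
move=> sS nSD; have cr := side_basis_CR_D sS nSD.
have [K0 KT0 [SK0 cS]] := sS.
have pw : piecewise 1 Th (side_basis S) (side_fun S).
  apply: (assemble_piecewise d_gt0 hTh) => K KT.
  by apply: Pk1_affine; exact: side_fun_affine.
have Lb : Linfty Omega (side_basis S) by case: cr => -[].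
have PE := Pi_h_piecewise hTh Lb pw (fun K _ => side_fun_affine S K).
have UP : U (Pi_h Th (side_basis S)).
  split; first by rewrite PE; apply: (assemble_Linfty hTh) => K _; exact: affine_cst.
  by exists (side_basis S) => //; exact: aeW.
have U0 : U 0.
  by apply: (Pi_h_image_null _ hTh) => //; [exact: (Linfty_cst _ 0)|exact: aeW].
have -> : assemble Th (fun K _ => (S `<=` K)%fset%:R) =
    d.+1%:R *: Pi_h Th (side_basis S) + 0.
  rewrite PE addr0; apply/funext => x.
  rewrite [RHS]mulr_sumr; apply: eq_big_seq => K KT /=.
  rewrite mean_side_fun//; case: (S `<=` K)%fset.
    by rewrite mulrA divff// pnatr_eq0.
  by rewrite !mul0r mulr0.
exact: (Pi_h_image_lin d_gt0 hTh bO).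
Qed.

(** Thus neighbouring elements have opposite indicators modulo the image. *)
Lemma shared_side_image K K' S : lipschitz_boundary Omega ->
  GammaD `<=` boundary Omega -> K \in Th -> K' \in Th -> K != K' ->
  side_of S K -> side_of S K' -> U (e K + e K').
Proof.
move=> lO DO KT KT' KK' sS sS'.
have nSD : ~ conv S `<=` GammaD.
  move=> SD; apply: (shared_side_interior hTh d_gt0 oO lO KT KT' KK' sS sS').
  exact: subset_trans DO.
have : U (assemble Th (fun K _ => (S `<=` K)%fset%:R)).
  by apply: side_indic_image => //; exists K.
congr (U _); apply/funext => x; rewrite /assemble.
rewrite (bigD1_seq K) ?fset_uniq//= (proj1 sS) mul1r; congr (_ + _).
rewrite big_mkcond (bigD1_seq K') ?fset_uniq//= eq_sym KK' (proj1 sS') mul1r.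
rewrite big_seq_cond big1 ?addr0// => K'' /andP[KT'' K2]; case: ifP => // K1.
have [SK|] := boolP (S `<=` K'')%fset; last by rewrite mul0r.
have sS'' : side_of S K'' by split => //; case: sS.
have [] := side_at_most_two hTh d_gt0 KT KT' KT'' KK' sS sS' sS''.
  by move=> E; rewrite E eqxx in K1.
by move=> E; rewrite E eqxx in K2.
Qed.

(** A boundary side belongs to one element only, because two elements sharing it
    would put it into the domain. *)
Lemma neumann_side_image K S : lipschitz_boundary Omega ->
  K \in Th -> side_of S K -> conv S `<=` boundary Omega ->
  ~ conv S `<=` GammaD -> U (e K).
Proof.
move=> lO KT sS SO nSD.
have : U (assemble Th (fun K _ => (S `<=` K)%fset%:R)).
  by apply: side_indic_image => //; exists K.
congr (U _); apply/funext => x; rewrite /assemble.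
rewrite (bigD1_seq K) ?fset_uniq//= (proj1 sS) mul1r.
rewrite big_seq_cond big1 ?addr0// => K' /andP[KT' K'K].
have [SK|] := boolP (S `<=` K')%fset; last by rewrite mul0r.
have sS' : side_of S K' by split => //; case: sS.
exfalso; apply: (shared_side_interior hTh d_gt0 oO lO KT' KT K'K sS' sS).
exact: SO.
Qed.

(** The difference vanishes almost everywhere in [Omega]. *)
Lemma broken_P0_assemble w : broken_Pk 0 Th Omega w ->
  exists c : {fset point} -> R, U (w - assemble Th (fun K _ => c K)).
Proof.
move=> [Lw [q wq]].
have {}wq K : exists c : R, K \in Th -> w = (fun=> c) %[ae mu in conv K].
  have [KT|_] := boolP (K \in Th); last by exists 0.
  have [/Pk0_cst[c qc] wK] := wq K KT; exists c => _.
  by apply: filterS wK => x h Kx; rewrite h.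
have [c cw] := choice wq; exists c.
have Lg : Linfty Omega (assemble Th (fun K _ => c K)).
  by apply: (assemble_Linfty hTh) => K _; exact: affine_cst.
apply: (Pi_h_image_null _ hTh).
  by rewrite addrC -scaleN1r; exact: Linfty_lin.
have := ae_fset (fun K KT => cw K KT); have := ae_generic d_gt0 hTh.
apply: filterS2 => x gx cx Ox.
have [K KT Kx] := tri_cover hTh Ox.
have -> : (w - assemble Th (fun K _ => c K)) x = w x - assemble Th (fun K _ => c K) x by [].
by rewrite (assemble_generic hTh _ gx KT Kx) (cx K KT Kx) subrr.
Qed.

Lemma indic_broken K : K \in Th -> broken_Pk 0 Th Omega (e K).
Proof.
move=> KT; have -> : e K = assemble Th (fun K' _ => (K' == K)%:R).
  apply/funext => x; rewrite /assemble (bigD1_seq K) ?fset_uniq//= eqxx mul1r.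
  by rewrite big1 ?addr0// => K' /negbTE->; rewrite mul0r.
split; first by apply: (assemble_Linfty hTh) => K' _; exact: affine_cst.
exists (fun K' _ => (K' == K)%:R); apply: (assemble_piecewise d_gt0 hTh).
by move=> K' _; exact: Pk_cst.
Qed.

Lemma Pi_h_image_broken : U `<=` broken_Pk 0 Th Omega.
Proof.
move=> w [Lw [v Cv wv]]; split => //.
pose c K := (fine (mu (conv K)))^-1 * \int[mu]_(y in conv K) v y.
exists (fun K _ => c K) => K KT; split; first exact: Pk_cst.
apply: filterS2 wv (ae_generic d_gt0 hTh) => x wx gx Kx.
rewrite wx; last exact: generic_interior gx KT Kx.
exact: (assemble_generic hTh (fun K _ => c K)).
Qed.

End crouzeix_raviart.

(** * Surjectivity up to codimension one *)

Unset Implicit Arguments.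

Theorem corollary3p2 (R : realType) (d : nat) (hd : (0 < d)%N)
    (Omega : set 'rV[R]_d) (Th : {fset {fset 'rV[R]_d}})
    (GammaD GammaN : set 'rV[R]_d)
    (hOmega : bounded_polyhedral_lipschitz_domain Omega)
    (hTh : regular_triangulation Th Omega)
    (hGamma : boundary_partition Th Omega GammaD GammaN) :
  (GammaD <> boundary Omega ->
     Pi_h_image Th Omega (CR_D Th Omega GammaD) = broken_Pk 0 Th Omega) /\
  (GammaD = boundary Omega ->
     codim_le (Pi_h_image Th Omega (CR_D Th Omega GammaD))
              (broken_Pk 0 Th Omega) 1).
Proof.
have [[x0 Ox0] oO cO _ [_ lO]] := hOmega.
have [bE [D Dsub [DE NE]]] := hGamma.
have bO : boundary Omega `<=` \bigcup_(S in sides Th) conv S.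
  rewrite bE DE NE => x [[S SD Sx]|[S [[sS _] _] Sx]]; exists S => //.
  by case: (Dsub S SD).
have DO : GammaD `<=` boundary Omega by rewrite bE; exact: subsetUl.
set U := Pi_h_image _ _ _; set W := broken_Pk _ _ _.
pose e K : 'rV[R]_d -> R := \1_(conv K).
have UW : U `<=` W by exact: (Pi_h_image_broken hd hTh bO).
have Ulin (a : R) v w : U v -> U w -> U (a *: v + w).
  exact: (Pi_h_image_lin hd hTh bO).
have U0 : U 0.
  by apply: (Pi_h_image_null _ hTh) => //; [exact: (Linfty_cst _ 0)|exact: aeW].
have Uadd v w : U v -> U w -> U (v + w).
  by move=> Uv; rewrite -[v]scale1r; exact: Ulin.
have Uscale (a : R) v : U v -> U (a *: v).
  by move=> Uv; rewrite -[_ *: _]addr0; exact: Ulin.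
have Uopp v : U v -> U (- v) by rewrite -scaleN1r; exact: Uscale.
have share K K' S : K \in Th -> K' \in Th -> K != K' -> side_of S K ->
    side_of S K' -> U (e K + e K').
  exact: (shared_side_image hd hTh oO bO lO DO).
have sumE c : assemble Th (fun K _ => c K) = \sum_(K <- Th) c K *: e K.
  by apply/funext => x; rewrite fct_sumE.
split => [DneqO|_].
  apply/seteqP; split => // w Ww.
  (* the boundary side through a point outside [GammaD] is a Neumann side *)
  have [S [[K0 KT0 sS] SO] nSD] : exists2 S,
      boundary_sides Th Omega S & ~ conv S `<=` GammaD.
    apply: contrapT => h; apply: DneqO; apply/seteqP; split => // x.
    rewrite {1}bE => -[//|]; rewrite NE => -[S [bS _] Sx].
    have [SD|SD] := pselect (conv S `<=` GammaD); first exact: SD.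
    by exfalso; apply: h; exists S.
  have UK : forall K, K \in Th -> U (e K).
    apply: (strongly_connected hTh oO cO (K0 := K0)) => //; last first.
      exact: (neumann_side_image hd hTh oO bO lO KT0 sS SO nSD).
    move=> K K' S' KT KT' sS' sS''; have [<-//|KK'] := eqVneq K K'.
    move=> UK; have := Uadd _ _ (share K K' S' KT KT' KK' sS' sS'') (Uopp _ UK).
    by rewrite addrAC subrr add0r.
  have [c Uc] := broken_P0_assemble GammaD hd hTh Ww.
  rewrite -[w](subrK (assemble Th (fun K _ => c K))); apply: (Uadd) => //.
  rewrite sumE big_seq; elim/big_ind: _ => // K KT.
  exact: Uscale (UK K KT).
have [K0 KT0 _] := tri_cover hTh Ox0.
(* [s] is the sign given by the parity of a chain of elements from [K0] to [K] *)
have UK K : K \in Th -> exists s : R, U (e K - s *: e K0).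
  apply: (strongly_connected hTh oO cO (K0 := K0)
    (P := fun K => exists s : R, U (e K - s *: e K0))) => //; last first.
    by exists 1; rewrite scale1r subrr.
  move=> K1 K2 S KT1 KT2 sS1 sS2 [s Us]; have [<-|K12] := eqVneq K1 K2.
    by exists s.
  exists (- s).
  have := Uadd _ _ (share K1 K2 S KT1 KT2 K12 sS1 sS2) (Uopp _ Us).
  by rewrite opprB addrC addrA subrK scaleNr opprK addrC.
have We K : K \in Th -> W (e K).
  exact: (indic_broken hd hTh).
split.
- split; first by rewrite inE.
  by move=> a v w; rewrite !inE; exact: Ulin.
- split; first by rewrite inE; exact: UW.
  by move=> a v w; rewrite !inE; exact: broken_Pk_lin.
- exact: UW.
- exists (fun=> e K0); first by move=> _; exact: We.
  move=> w Ww; have [c Uc] := broken_P0_assemble GammaD hd hTh Ww.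
  have [s Us] : exists s : R,
      U (assemble Th (fun K _ => c K) - s *: e K0).
    rewrite sumE big_seq; elim/big_ind: _ => [|f g [s Us] [t Ut]|K KT].
    - by exists 0; rewrite scale0r subr0.
    - exists (s + t); rewrite scalerDl opprD addrACA; exact: Uadd.
    - have [s Us] := UK K KT; exists (c K * s).
      by rewrite -scalerA -scalerBr; exact: Uscale.
  exists (w - s *: e K0); last first.
    by exists (fun=> s); rewrite big_ord1 subrK.
  rewrite -[w](subrK (assemble Th (fun K _ => c K))) -addrA; exact: Uadd.
Qed.
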